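(* Let $g\in\mathscr{L}$, let $\mathbb{A}=(A_1,\ldots,A_n)$ be an $n$-tuple of positive definite matrices in $\mathcal{M}_k$ with $mI\le A_i\le MI$ $(i=1,\ldots,n)$ for some scalars $0<m<M$, and let $w=(w_1,\ldots,w_n)$ be a weight vector. Put $h=\frac{M}{m}$ and $f(\mathbb{A})=(f(A_1),\ldots,f(A_n))$. (I) If $f:(0,\infty)\to(0,\infty)$ is an operator monotone function, then $$\sigma_g\left(w;f(\mathbb{A})\right)\le K(h,2)\,f\left(\sigma_g(w;\mathbb{A})\right).$$ (II) If $f:(0,\infty)\to(0,\infty)$ is an operator monotone decreasing function, then $$f\left(\sigma_g(w;\mathbb{A})\right)\le K(h,2)\,\sigma_g\left(w;f(\mathbb{A})\right).$$
   Context: $\mathcal{M}_k$ is the algebra of complex $k\times k$ matrices, $I$ the identity matrix, and $A\le B$ for Hermitian matrices means $B-A$ is positive semidefinite. Functions are applied to positive definite matrices by functional calculus. A function $f$ on $(0,\infty)$ is operator monotone (resp. operator monotone decreasing) if $A\le B$ implies $f(A)\le f(B)$ (resp. $f(A)\ge f(B)$) for positive definite matrices $A,B$ of every size. A weight vector is $w=(w_1,\ldots,w_n)$ with all $w_i>0$ and $\sum_{i=1}^n w_i=1$. $\mathscr{L}$ is the set of all (real-valued) operator monotone functions $g$ on $(0,\infty)$ satisfying $g(1)=0$ and $g'(1)=1$. For $g\in\mathscr{L}$, a weight vector $w$ and positive definite $\mathbb{A}=(A_1,\ldots,A_n)$, $\sigma_g(w;\mathbb{A})$ denotes the (unique) positive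 definite solution $X$ of the generalized Karcher equation $\sum_{i=1}^{n}w_i\,g\left(X^{-1/2}A_iX^{-1/2}\right)=0$. The Kantorovich constant is $K(h,2)=\frac{(h+1)^2}{4h}$. *)

(* Defs.v *)
From HB Require Import structures.
From mathcomp Require Import all_boot all_order all_algebra.
From mathcomp Require Import sesquilinear spectral complex.
From mathcomp Require Import all_classical all_reals all_analysis.

Set Implicit Arguments.
Unset Strict Implicit.
Unset Printing Implicit Defensive.

Import Order.TTheory GRing.Theory Num.Theory.
Import numFieldNormedType.Exports.
Local Open Scope ring_scope.
Local Open Scope sesquilinear_scope.
Local Open Scope complex_scope.

Section Matrices.
Variable R : realType.

(* On [R[i]], [0 <= z] means that z is real and nonnegative. *)
Definition psdmx (k : nat) (A : 'M[R[i]]_k) : Prop :=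
  A \is hermsymmx /\ forall v : 'cV[R[i]]_k, 0 <= (v^t* *m A *m v) 0 0.

Definition pdmx (k : nat) (A : 'M[R[i]]_k) : Prop :=
  A \is hermsymmx /\
  forall v : 'cV[R[i]]_k, v != 0 -> 0 < (v^t* *m A *m v) 0 0.

Definition loewner_le (k : nat) (A B : 'M[R[i]]_k) : Prop := psdmx (B - A).

(* f(A), meaningful for Hermitian A, whose spectral decomposition is
   A = P^-1 diag(d) P with P unitary and d real. *)
Definition mxfun (k : nat) (f : R -> R) (A : 'M[R[i]]_k) : 'M[R[i]]_k :=
  invmx (spectralmx A) *m
  diag_mx (map_mx (fun z : R[i] => (f (complex.Re z))%:C) (spectral_diag A)) *m
  spectralmx A.

(* Functions on (0, +oo) are total functions R -> R; the predicates below only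
   involve their values at positive reals. *)
Definition operator_monotone (f : R -> R) : Prop :=
  forall (k : nat) (A B : 'M[R[i]]_k), pdmx A -> pdmx B ->
    loewner_le A B -> loewner_le (mxfun f A) (mxfun f B).

Definition operator_decreasing (f : R -> R) : Prop :=
  forall (k : nat) (A B : 'M[R[i]]_k), pdmx A -> pdmx B ->
    loewner_le A B -> loewner_le (mxfun f B) (mxfun f A).

Definition class_L (g : R -> R) : Prop :=
  [/\ operator_monotone g, g 1 = 0 & is_derive (1 : R) (1 : R) g (1 : R)].

Definition weight_vector (n : nat) (w : 'I_n -> R) : Prop :=
  (forall i, 0 < w i) /\ \sum_(i < n) w i = 1.

Definition invsqrtmx (k : nat) (X : 'M[R[i]]_k) : 'M[R[i]]_k :=
  mxfun (fun x => (Num.sqrt x)^-1) X.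

Definition karcher_solution (n k : nat) (g : R -> R) (w : 'I_n -> R)
    (A : 'I_n -> 'M[R[i]]_k) (X : 'M[R[i]]_k) : Prop :=
  pdmx X /\
  \sum_(i < n) (w i)%:C *: mxfun g (invsqrtmx X *m A i *m invsqrtmx X) = 0.

(* The default value 0 would only be taken if there were no solution, and it is
   not positive definite when 0 < k. *)
Definition sigma (n k : nat) (g : R -> R) (w : 'I_n -> R)
    (A : 'I_n -> 'M[R[i]]_k) : 'M[R[i]]_k :=
  xget 0 [set X | karcher_solution g w A X]%classic.

Definition kantorovich (h : R) : R := (h + 1) ^+ 2 / (4 * h).

End Matrices.

(* Main.v *)
(** If [X := sigma g w A] then [1 - 1/x <= g x <= x - 1] squeezes [X] between
    the weighted harmonic and arithmetic means of the [A i], and the Kantorovich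
    inequality makes the two comparable:
    [sum w_i A_i <= K (sum w_i A_i^-1)^-1 <= K X].  Operator concavity of [f] and
    [f (K x) <= K f x] then give (I); (II) is the same argument for [1 / f].

    Since [sigma] is defined by choice, a solution of the Karcher equation has to
    be produced.  Put [G g X := sum_i w_i X^(1/2) g(X^(-1/2) A_i X^(-1/2)) X^(1/2)].
    If [g] is bounded below, [G g X = 0] is a fixed point equation for a monotone
    map and is solved by decreasing iteration from [M I].  In general [g] is the
    decreasing limit, as [c] tends to [1], of
    [x |-> g (c x + 1 - c) / c], which is bounded below; the corresponding
    solutions decrease to a solution for [g].

    All limits are taken in the Loewner order, and Jensen's operator inequality
    is the only analytic property of operator monotone functions that is needed
    (no integral representation). *)

Require Import Defs.
From HB Require Import structures.
From mathcomp Require Import all_boot all_order all_algebra.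
From mathcomp Require Import sesquilinear spectral complex.
From mathcomp Require Import all_classical all_reals all_analysis.
From mathcomp Require Import ring lra.

Set Implicit Arguments.
Unset Strict Implicit.
Unset Printing Implicit Defensive.

Import Order.TTheory GRing.Theory Num.Theory.
Import numFieldNormedType.Exports.
Local Open Scope ring_scope.
Local Open Scope sesquilinear_scope.
Local Open Scope complex_scope.

(** * The Loewner order *)

Section Loewner.
Variable R : realType.
Local Notation C := R[i].

Lemma ge0_realcE (a : R) : (0 <= a%:C) = (0 <= a).
Proof. exact: ler0c. Qed.

Lemma conjC_real (a : R) : (@Num.conj C) (a%:C) = a%:C :> C.
Proof. exact: conjc_real. Qed.

Lemma ctmxM m n p (A : 'M[C]_(m, n)) (B : 'M[C]_(n, p)) :
  (A *m B)^t* = B^t* *m A^t*.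
Proof. by rewrite trmx_mul map_mxM. Qed.

Lemma ctmxD m n (A B : 'M[C]_(m, n)) : (A + B)^t* = A^t* + B^t*.
Proof. by rewrite linearD /= map_mxD. Qed.

Lemma ctmxB m n (A B : 'M[C]_(m, n)) : (A - B)^t* = A^t* - B^t*.
Proof. by rewrite linearB /= map_mxB. Qed.

Lemma ctmxZ m n (a : R) (A : 'M[C]_(m, n)) : (a%:C *: A)^t* = a%:C *: A^t*.
Proof.
by apply/matrixP => i j; rewrite !mxE rmorphM; congr (_ * _); exact: conjC_real.
Qed.

Lemma ctmx_scalar n (a : R) : ((a%:C)%:M : 'M[C]_n)^t* = (a%:C)%:M.
Proof. by rewrite tr_scalar_mx map_scalar_mx; congr scalar_mx; exact: conjC_real. Qed.

Lemma ctmx1 n : (1%:M : 'M[C]_n)^t* = 1%:M.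
Proof. by rewrite tr_scalar_mx map_scalar_mx /= conjC1. Qed.

Lemma ctmx0 m n : (0 : 'M[C]_(m, n))^t* = 0.
Proof. by rewrite trmx0 map_mx0. Qed.

Lemma hermP n (A : 'M[C]_n) : reflect (A^t* = A) (A \is hermsymmx).
Proof.
rewrite qualifE /= expr0 scale1r eq_sym; exact: eqP.
Qed.

Lemma ctmx_congr n p (V : 'M[C]_(n, p)) (A : 'M[C]_n) :
  A^t* = A -> (V^t* *m A *m V)^t* = V^t* *m A *m V.
Proof. by move=> hA; rewrite !ctmxM trmxCK hA mulmxA. Qed.

Lemma psd_ctmx n (A : 'M[C]_n) : psdmx A -> A^t* = A.
Proof. by case=> /hermP. Qed.

Lemma pd_ctmx n (A : 'M[C]_n) : pdmx A -> A^t* = A.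
Proof. by case=> /hermP. Qed.

Lemma pd_psd n (A : 'M[C]_n) : pdmx A -> psdmx A.
Proof.
case=> hA pA; split=> // v; have [->|/pA/ltW//] := eqVneq v 0.
by rewrite mulmx0 mxE.
Qed.

Lemma psd_congr n p (V : 'M[C]_(n, p)) (A : 'M[C]_n) :
  psdmx A -> psdmx (V^t* *m A *m V).
Proof.
move=> pA; split; first exact/hermP/ctmx_congr/psd_ctmx.
by move=> v; have := pA.2 (V *m v); rewrite ctmxM !mulmxA.
Qed.

Lemma pd_congr n p (V : 'M[C]_(n, p)) (A : 'M[C]_n) :
  (forall v : 'cV_p, V *m v = 0 -> v = 0) -> pdmx A -> pdmx (V^t* *m A *m V).
Proof.
move=> injV pA; split; first exact/hermP/ctmx_congr/pd_ctmx.
move=> v v0; have /pA.2 : V *m v != 0 by apply: contraNneq v0 => /injV ->.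
by rewrite ctmxM !mulmxA.
Qed.

Lemma psdD n (A B : 'M[C]_n) : psdmx A -> psdmx B -> psdmx (A + B).
Proof.
move=> pA pB; split; first by apply/hermP; rewrite ctmxD !psd_ctmx.
by move=> v; rewrite mulmxDr mulmxDl mxE addr_ge0// ?pA.2 ?pB.2.
Qed.

Lemma pdD n (A B : 'M[C]_n) : pdmx A -> psdmx B -> pdmx (A + B).
Proof.
move=> pA pB; split; first by apply/hermP; rewrite ctmxD pd_ctmx ?psd_ctmx.
by move=> v v0; rewrite mulmxDr mulmxDl mxE ltr_wpDr// ?pA.2 ?pB.2.
Qed.

Lemma psdZ n (a : R) (A : 'M[C]_n) : 0 <= a -> psdmx A -> psdmx (a%:C *: A).
Proof.
move=> a0 pA; split; first by apply/hermP; rewrite ctmxZ psd_ctmx.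
by move=> v; rewrite -scalemxAr -scalemxAl mxE mulr_ge0 ?ge0_realcE ?pA.2.
Qed.

Lemma pdZ n (a : R) (A : 'M[C]_n) : 0 < a -> pdmx A -> pdmx (a%:C *: A).
Proof.
move=> a0 pA; split; first by apply/hermP; rewrite ctmxZ pd_ctmx.
by move=> v v0; rewrite -scalemxAr -scalemxAl mxE mulr_gt0 ?ltcR ?pA.2.
Qed.

Lemma psd0 n : psdmx (0 : 'M[C]_n).
Proof.
by split=> [|v]; [apply/hermP; rewrite ctmx0|rewrite mulmx0 mul0mx mxE].
Qed.

Lemma cV_neq0 n (v : 'cV[C]_n) : v != 0 -> exists i, v i 0 != 0.
Proof.
move=> v0; apply/existsP; rewrite -negb_forall; apply: contra v0 => /forallP h.
by apply/eqP/matrixP => i j; rewrite ord1 mxE; exact/eqP/h.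
Qed.

Lemma cV_form_gt0 n (v : 'cV[C]_n) : v != 0 -> 0 < (v^t* *m v) 0 0.
Proof.
move=> /cV_neq0[i vi].
rewrite mxE (bigD1 i) //= ltr_wpDr//.
  by apply: sumr_ge0 => j _; rewrite !mxE mulrC mul_conjC_ge0.
by rewrite !mxE mulrC mul_conjC_gt0.
Qed.

Lemma pd1 n : pdmx (1%:M : 'M[C]_n).
Proof.
by split=> [|v v0]; [apply/hermP; rewrite ctmx1|rewrite mulmx1 cV_form_gt0].
Qed.

Lemma pd_scalar n (a : R) : 0 < a -> pdmx ((a%:C)%:M : 'M[C]_n).
Proof. by move=> a0; rewrite -scalemx1; apply: pdZ => //; exact: pd1. Qed.

Lemma psd_sum n (I : finType) (F : I -> 'M[C]_n) :
  (forall i, psdmx (F i)) -> psdmx (\sum_i F i).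
Proof. by move=> h; elim/big_ind : _; [exact: psd0|move=> X Y; exact: psdD|]. Qed.

Lemma lel_refl n (A : 'M[C]_n) : loewner_le A A.
Proof. by rewrite /loewner_le subrr; exact: psd0. Qed.

Lemma lel_trans n (B A D : 'M[C]_n) :
  loewner_le A B -> loewner_le B D -> loewner_le A D.
Proof.
move=> AB BD; rewrite /loewner_le (_ : D - A = (B - A) + (D - B)).
  exact: psdD AB BD.
by rewrite [RHS]addrC subrKA.
Qed.

Lemma lelD n (A B A' B' : 'M[C]_n) :
  loewner_le A B -> loewner_le A' B' -> loewner_le (A + A') (B + B').
Proof. by move=> h h'; rewrite /loewner_le opprD addrACA; exact: psdD h h'. Qed.

Lemma lelZ n (a : R) (A B : 'M[C]_n) :
  0 <= a -> loewner_le A B -> loewner_le (a%:C *: A) (a%:C *: B).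
Proof. by move=> a0 h; rewrite /loewner_le -scalerBr; exact: psdZ. Qed.

Lemma lel_congr n p (V : 'M[C]_(n, p)) (A B : 'M[C]_n) :
  loewner_le A B -> loewner_le (V^t* *m A *m V) (V^t* *m B *m V).
Proof.
by move=> h; rewrite /loewner_le -mulmxBl -mulmxBr; exact: psd_congr.
Qed.

Lemma lel_sum n (I : finType) (F G : I -> 'M[C]_n) :
  (forall i, loewner_le (F i) (G i)) -> loewner_le (\sum_i F i) (\sum_i G i).
Proof. by move=> h; rewrite /loewner_le -sumrB; exact: psd_sum. Qed.

Lemma lel_scalar n (a b : R) :
  a <= b -> loewner_le ((a%:C)%:M : 'M[C]_n) (b%:C)%:M.
Proof.
move=> ab; rewrite /loewner_le -raddfB -rmorphB /= -scalemx1.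
by apply: psdZ; [rewrite subr_ge0|exact/pd_psd/pd1].
Qed.

Lemma pd_lel n (A B : 'M[C]_n) : pdmx A -> loewner_le A B -> pdmx B.
Proof. by move=> pA /(pdD pA); rewrite addrC subrK. Qed.

(** The order is closed: an inequality that holds up to every positive multiple of one fixed [D]
    holds exactly. Later limit arguments end here, so no topology on matrices is used there. *)
Lemma lel_ext n (A B D : 'M[C]_n) : psdmx D ->
  (forall e : R, 0 < e -> loewner_le A (B + e%:C *: D)) -> loewner_le A B.
Proof.
move=> pD h.
have hBA : (B - A)^t* = B - A.
  have := psd_ctmx (h 1 ltr01). rewrite addrAC (ctmxD (B - A)) ctmxZ (psd_ctmx pD).
  exact: addIr.
split=> [|v]; first exact/hermP.
have {}h e : 0 < e -> 0 <= (v^t* *m (B - A) *m v) 0 0 +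
                          e%:C * (v^t* *m D *m v) 0 0.
  move=> e0; have := (h e e0).2 v; rewrite addrAC mulmxDr mulmxDl mxE.
  by rewrite -scalemxAr -scalemxAl [X in _ + X]mxE.
have := pD.2 v; move: h.
case: ((v^t* *m (B - A) *m v) 0 0) => x y.
case: ((v^t* *m D *m v) 0 0) => a b h.
rewrite lecE /= => /andP[/eqP b0 a0]; rewrite {}b0 in h *.
have {}h e : 0 < e -> y == 0 /\ 0 <= x + e * a.
  by move=> /h; rewrite lecE /= !mulr0 !mul0r !addr0 subr0 => /andP[-> ?].
have [y0 _] := h 1 ltr01.
rewrite lecE /= y0/= leNgt; apply/negP => x0.
have a1 : 0 < a + 1 by lra.
(* For [x < 0] this [e] makes [x + e * a] equal to [x / (a + 1)], still negative; the added 1 covers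
   [a = 0]. *)
have [_] := h (- x / (a + 1)) ltac:(by rewrite divr_gt0// oppr_gt0).
have -> : x + - x / (a + 1) * a = x / (a + 1) by field; rewrite gt_eqF.
by rewrite leNgt pmulr_llt0 ?invr_gt0// x0.
Qed.

End Loewner.

(** * Functional calculus of Hermitian matrices *)

(* A sealed copy of [mxfun]: comparing [mxfun f A] with [mxfun f B] during
   unification would unfold both down to complex arithmetic. *)
HB.lock Definition fcalc (R : realType) (k : nat) (f : R -> R)
  (A : 'M[R[i]]_k) : 'M[R[i]]_k := mxfun f A.

(** A change of basis on both sides of an intertwining relation, used to pass from Hermitian
    matrices to their diagonal forms and back. *)
Lemma intertwine_conj (F : comNzRingType) m n (D : 'M[F]_m) (D' : 'M[F]_n)
    (P P' : 'M[F]_m) (Q Q' : 'M[F]_n) (V : 'M[F]_(m, n)) :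
  P' *m P = 1%:M -> Q *m Q' = 1%:M ->
  D *m V = V *m D' ->
  P *m D *m P' *m (P *m V *m Q) = P *m V *m Q *m (Q' *m D' *m Q).
Proof.
move=> hP hQ e; rewrite !mulmxA -(mulmxA _ P' P) hP mulmx1.
by rewrite -(mulmxA _ Q Q') hQ mulmx1 -(mulmxA P D) e !mulmxA.
Qed.

Section FunctionalCalculus.
Variable R : realType.
Local Notation C := R[i].

Lemma mxfunE k (f : R -> R) (A : 'M[C]_k) : mxfun f A = fcalc f A.
Proof. by rewrite fcalc.unlock. Qed.

Definition rdiag n (d : 'I_n -> R) : 'M[C]_n := diag_mx (\row_i (d i)%:C).

(** Real parts of the eigenvalues; for Hermitian [A] this is the spectrum itself. *)
Definition spec n (A : 'M[C]_n) (x : R) : Prop :=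
  exists i, complex.Re (spectral_diag A 0 i) = x.

Lemma fcalcE n (f : R -> R) (A : 'M[C]_n) :
  fcalc f A = (spectralmx A)^t* *m
    rdiag (fun i => f (complex.Re (spectral_diag A 0 i))) *m spectralmx A.
Proof.
rewrite -mxfunE /mxfun (invmx_unitary (spectral_unitarymx A)).
apply: (f_equal (fun D => _ *m diag_mx D *m _)).
by apply/rowP => i; rewrite !mxE.
Qed.

Lemma spectralE n (A : 'M[C]_n) : A^t* = A ->
  A = (spectralmx A)^t* *m
    rdiag (fun i => complex.Re (spectral_diag A 0 i)) *m spectralmx A.
Proof.
move=> /hermP hA.
have /orthomx_spectralP {1}-> := hermitian_normalmx hA.
rewrite (invmx_unitary (spectral_unitarymx A)).
apply: (f_equal (fun D => _ *m diag_mx D *m _)).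
apply/rowP => i; rewrite !mxE RRe_real//.
exact/mxOverP/hermitian_spectral_diag_real.
Qed.

Lemma spectralKl n (A : 'M[C]_n) : spectralmx A *m (spectralmx A)^t* = 1%:M.
Proof. exact/unitarymxP/spectral_unitarymx. Qed.

Lemma spectralKr n (A : 'M[C]_n) : (spectralmx A)^t* *m spectralmx A = 1%:M.
Proof. exact/mulmx1C/spectralKl. Qed.

Lemma rdiagM n (d d' : 'I_n -> R) :
  rdiag d *m rdiag d' = rdiag (fun i => d i * d' i).
Proof.
rewrite mul_diag_mx; apply/matrixP => i j; rewrite !mxE rmorphM.
by case: eqP => [->|]; rewrite ?mulr1n// !mulr0n mulr0.
Qed.

(** Entrywise the hypothesis says [d i * W i j = W i j * d' j], so either [W i j] vanishes or
    [d i = d' j], and then [f] takes the same value at both. *)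
Lemma rdiag_intertwine m n (f : R -> R) (d : 'I_m -> R) (d' : 'I_n -> R)
    (W : 'M[C]_(m, n)) :
  rdiag d *m W = W *m rdiag d' ->
  rdiag (f \o d) *m W = W *m rdiag (f \o d').
Proof.
move=> /matrixP h; apply/matrixP => i j; move: (h i j).
rewrite !mul_diag_mx !mul_mx_diag !mxE /= mulrC => e.
have [->|w0] := eqVneq (W i j) 0; first by rewrite mulr0 mul0r.
by move/(mulfI w0): e => [->]; rewrite mulrC.
Qed.

Lemma spectral_diagE n (A : 'M[C]_n) : A^t* = A ->
  spectralmx A *m A *m (spectralmx A)^t* =
  rdiag (fun i => complex.Re (spectral_diag A 0 i)).
Proof.
move=> hA; rewrite [X in _ *m X *m _](spectralE hA).
by rewrite -!mulmxA spectralKl mulmx1 mulmxA spectralKl mul1mx.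
Qed.

(* This replaces polynomial interpolation of [f] on the spectrum. *)
Lemma fcalc_intertwine m n (f : R -> R) (A : 'M[C]_m) (B : 'M[C]_n)
    (V : 'M[C]_(m, n)) :
  A^t* = A -> B^t* = B -> A *m V = V *m B ->
  fcalc f A *m V = V *m fcalc f B.
Proof.
move=> hA hB e.
have := intertwine_conj (P := spectralmx A) (spectralKr A) (spectralKr B) e.
rewrite (spectral_diagE hA) (spectral_diagE hB) => /(rdiag_intertwine f) e'.
have := intertwine_conj (spectralKl A) (spectralKl B) e'.
rewrite -(fcalcE f A) -(fcalcE f B) (_ : _ *m _ *m spectralmx B = V)//.
by rewrite !mulmxA spectralKr mul1mx -(mulmxA V) spectralKr mulmx1.
Qed.

Lemma rdiag_ctmx n (d : 'I_n -> R) : (rdiag d)^t* = rdiag d.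
Proof.
apply/matrixP => i j; rewrite !mxE rmorphMn eq_sym.
by case: eqP => [->|]//; congr (_ *+ _); exact: conjC_real.
Qed.

Lemma fcalc_ctmx n (f : R -> R) (A : 'M[C]_n) : (fcalc f A)^t* = fcalc f A.
Proof. by rewrite fcalcE ctmx_congr// rdiag_ctmx. Qed.

(** The calculus does not depend on the diagonalisation: the product of [spectralmx A] with [U^t*]
    intertwines the two diagonal forms. This is what makes composition of functions work. *)
Lemma fcalc_conj n (f : R -> R) (U : 'M[C]_n) (d : 'I_n -> R) :
  U^t* *m U = 1%:M ->
  fcalc f (U^t* *m rdiag d *m U) = U^t* *m rdiag (f \o d) *m U.
Proof.
move=> hU; set A := (X in fcalc f X).
have hU' := mulmx1C hU.
have hA : A^t* = A by rewrite /A ctmx_congr// rdiag_ctmx.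
have : rdiag (fun i => complex.Re (spectral_diag A 0 i)) *m (spectralmx A *m U^t*)
    = spectralmx A *m U^t* *m rdiag d.
  rewrite -(spectral_diagE hA) /A -!mulmxA.
  by rewrite (mulmxA _ _ (U^t*)) spectralKr mul1mx hU' mulmx1.
move=> /(rdiag_intertwine f) e'.
have := intertwine_conj (spectralKl A) hU' e'.
have -> : (spectralmx A)^t* *m (spectralmx A *m U^t*) *m U = 1%:M.
  by rewrite !mulmxA spectralKr mul1mx.
by rewrite mulmx1 mul1mx -(fcalcE f A).
Qed.

Lemma fcalc_comp n (f g : R -> R) (A : 'M[C]_n) :
  fcalc f (fcalc g A) = fcalc (f \o g) A.
Proof. by rewrite (fcalcE g) fcalc_conj ?fcalcE// spectralKr. Qed.

Lemma eq_fcalc n (f g : R -> R) (A : 'M[C]_n) :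
  (forall x, spec A x -> f x = g x) -> fcalc f A = fcalc g A.
Proof.
move=> h; rewrite !fcalcE; apply: (f_equal (fun D => _ *m diag_mx D *m _)).
apply/rowP => i.
by rewrite !mxE h//; exists i.
Qed.

Lemma fcalc_id n (A : 'M[C]_n) : A^t* = A -> fcalc id A = A.
Proof. by move=> hA; rewrite fcalcE -spectralE. Qed.

Lemma fcalcD n (f g : R -> R) (A : 'M[C]_n) :
  fcalc (fun x => f x + g x) A = fcalc f A + fcalc g A.
Proof.
rewrite !fcalcE -mulmxDl -mulmxDr; congr (_ *m _ *m _).
by apply/matrixP => i j; rewrite !mxE rmorphD mulrnDl.
Qed.

Lemma fcalcZ n (a : R) (f : R -> R) (A : 'M[C]_n) :
  fcalc (fun x => a * f x) A = a%:C *: fcalc f A.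
Proof.
rewrite !fcalcE scalemxAl scalemxAr; congr (_ *m _ *m _).
by apply/matrixP => i j; rewrite !mxE rmorphM mulrnAr.
Qed.

Lemma fcalcM n (f g : R -> R) (A : 'M[C]_n) :
  fcalc (fun x => f x * g x) A = fcalc f A *m fcalc g A.
Proof.
rewrite !fcalcE !mulmxA -(mulmxA _ (spectralmx A)) spectralKl mulmx1.
by rewrite -(mulmxA _ (rdiag _) (rdiag _)) rdiagM.
Qed.

Lemma fcalc_cst n (a : R) (A : 'M[C]_n) : fcalc (fun=> a) A = (a%:C)%:M.
Proof.
rewrite fcalcE (_ : rdiag _ = (a%:C)%:M).
  by rewrite mul_mx_scalar -scalemxAl spectralKr scalemx1.
by apply/matrixP => i j; rewrite !mxE.
Qed.

Lemma fcalc_affine n (a b : R) (A : 'M[C]_n) : A^t* = A ->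
  fcalc (fun x => a * x + b) A = a%:C *: A + (b%:C)%:M.
Proof. by move=> hA; rewrite fcalcD fcalcZ fcalc_id// fcalc_cst. Qed.

Lemma fcalc_scale n (a : R) (f : R -> R) (A : 'M[C]_n) : A^t* = A ->
  fcalc f (a%:C *: A) = fcalc (fun x => f (a * x)) A.
Proof.
move=> hA; rewrite -{1}(fcalc_id hA) -fcalcZ fcalc_comp.
exact: eq_fcalc.
Qed.

Lemma fcalc_scalar n (a : R) (f : R -> R) :
  fcalc f ((a%:C)%:M : 'M[C]_n) = ((f a)%:C)%:M.
Proof. by rewrite -[in LHS](fcalc_cst a 0) fcalc_comp fcalc_cst. Qed.

Lemma psd_rdiag n (d : 'I_n -> R) : (forall i, 0 <= d i) -> psdmx (rdiag d).
Proof.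
move=> h; split=> [|v]; first exact/hermP/rdiag_ctmx.
rewrite mul_mx_diag mxE sumr_ge0// => i _.
rewrite !mxE mulrAC mulr_ge0 ?ge0_realcE//.
by rewrite mulrC mul_conjC_ge0.
Qed.

Lemma psd_fcalc n (f : R -> R) (A : 'M[C]_n) :
  (forall x, spec A x -> 0 <= f x) -> psdmx (fcalc f A).
Proof.
by move=> h; rewrite fcalcE; apply/psd_congr/psd_rdiag => i; apply: h; exists i.
Qed.

Lemma fcalc_le n (f g : R -> R) (A : 'M[C]_n) :
  (forall x, spec A x -> f x <= g x) -> loewner_le (fcalc f A) (fcalc g A).
Proof.
move=> h; rewrite /loewner_le.
have -> : fcalc g A - fcalc f A = fcalc (fun x => g x + -1 * f x) A.
  by rewrite fcalcD fcalcZ rmorphN1 scaleN1r.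
by apply: psd_fcalc => x /h; rewrite mulN1r subr_ge0.
Qed.

(** The witness is the [i]-th unit eigenvector, the adjoint of the [i]-th row of [spectralmx A];
    through it Loewner bounds become bounds on eigenvalues. *)
Lemma spec_form n (A : 'M[C]_n) x : A^t* = A -> spec A x ->
  exists2 v : 'cV[C]_n, (v^t* *m v) 0 0 = 1 & (v^t* *m A *m v) 0 0 = x%:C.
Proof.
move=> hA [i <-]; exists ((spectralmx A)^t* *m delta_mx i 0).
  rewrite ctmxM trmxCK mulmxA -(mulmxA _ (spectralmx A)) spectralKl mulmx1.
  rewrite trmx_delta map_delta_mx mul_delta_mx.
  by rewrite mxE !eqxx.
rewrite {2}(spectralE hA) ctmxM trmxCK !mulmxA.
rewrite -(mulmxA _ (spectralmx A)) spectralKl mulmx1.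
rewrite -(mulmxA _ (spectralmx A)) spectralKl mulmx1 -mulmxA mul_diag_mx.
rewrite trmx_delta map_delta_mx -rowE !mxE.
by rewrite !eqxx mulr1.
Qed.

Lemma spec_gt0 n (A : 'M[C]_n) x : pdmx A -> spec A x -> 0 < x.
Proof.
move=> pA /(spec_form (pd_ctmx pA))[v v1 e].
rewrite -(@ltcR R) -e; apply: pA.2.
by apply/eqP => v0; move: v1; rewrite v0 mulmx0 mxE => /esym/eqP; rewrite oner_eq0.
Qed.

Lemma spec_ge0 n (A : 'M[C]_n) x : psdmx A -> spec A x -> 0 <= x.
Proof.
move=> pA /(spec_form (psd_ctmx pA))[v v1 e].
by rewrite -(@lecR R) -e; apply: pA.2.
Qed.

Lemma spec_ge n (A : 'M[C]_n) a x : A^t* = A ->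
  loewner_le (a%:C)%:M A -> spec A x -> a <= x.
Proof.
move=> hA aA /(spec_form hA)[v v1 e].
have := aA.2 v; rewrite mulmxBr mulmxBl mxE e mul_mx_scalar -scalemxAl.
rewrite [X in _ + X]mxE [X in - X]mxE v1 mulr1.
by rewrite subr_ge0 lecR.
Qed.

Lemma spec_le n (A : 'M[C]_n) a x : A^t* = A ->
  loewner_le A (a%:C)%:M -> spec A x -> x <= a.
Proof.
move=> hA aA /(spec_form hA)[v v1 e].
have := aA.2 v; rewrite mulmxBr mulmxBl mxE [X in _ + X]mxE e mul_mx_scalar.
rewrite -scalemxAl [X in X + _]mxE v1 mulr1.
by rewrite subr_ge0 lecR.
Qed.

Lemma spec_bounds n (A : 'M[C]_n) : pdmx A ->
  exists a b, [/\ 0 < a, a <= b & forall x, spec A x -> a <= x <= b].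
Proof.
move=> pA.
pose d (i : 'I_n) := complex.Re (spectral_diag A 0 i).
have d0 i : 0 < d i by apply: (spec_gt0 pA); exists i.
(* [b] dominates every eigenvalue and every inverse eigenvalue, so [b^-1] is a lower bound; the
   summand 1 gives [b^-1 <= b], even for an empty matrix. *)
pose b := 1 + \sum_i (d i + (d i)^-1).
have b1 i : d i + (d i)^-1 <= b.
  rewrite /b (bigD1 i)//= addrCA ler_wpDr// addr_ge0// sumr_ge0// => j _.
  by rewrite addr_ge0// ?invr_ge0 ltW.
have b0 : 1 <= b.
  by rewrite lerDl sumr_ge0// => j _; rewrite addr_ge0// ?invr_ge0 ltW.
exists b^-1, b; split.
- by rewrite invr_gt0; lra.
- by rewrite (le_trans _ b0)// invf_le1//; lra.
- move=> _ [i <-]; have := b1 i; have := d0 i; rewrite -/(d i) => di bi.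
  have : 0 < (d i)^-1 by rewrite invr_gt0.
  move=> di'; apply/andP; split; last by lra.
  by rewrite -[leRHS]invrK lef_pV2 ?posrE//; lra.
Qed.

Lemma pd_fcalc n (f : R -> R) (A : 'M[C]_n) :
  (forall x, spec A x -> 0 < f x) -> pdmx (fcalc f A).
Proof.
move=> h; have hA := fcalc_ctmx f A; split; first exact/hermP.
move=> v v0; rewrite fcalcE !mulmxA -mulmxA.
set u := spectralmx A *m v.
have -> : v^t* *m (spectralmx A)^t* = u^t* by rewrite -ctmxM.
have u0 : u != 0.
  apply: contra_neq v0 => u0; rewrite -[v]mul1mx -(spectralKr A) -mulmxA -/u u0.
  by rewrite mulmx0.
have [i ui] := cV_neq0 u0; clearbody u.
rewrite mul_mx_diag mxE (bigD1 i)//= ltr_wpDr//.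
  apply: sumr_ge0 => j _; rewrite !mxE mulrAC mulr_ge0//.
    by rewrite mulrC mul_conjC_ge0.
  by rewrite ge0_realcE ltW// h//; exists j.
rewrite !mxE mulrAC mulr_gt0//; first by rewrite mulrC mul_conjC_gt0.
by rewrite ltcR h//; exists i.
Qed.

Lemma fcalc_inv n (A : 'M[C]_n) : pdmx A -> fcalc GRing.inv A *m A = 1%:M.
Proof.
move=> pA; rewrite -[X in _ *m X](fcalc_id (pd_ctmx pA)) -fcalcM.
rewrite (@eq_fcalc _ _ (fun=> 1)) ?fcalc_cst//.
by move=> x /(spec_gt0 pA) x0; rewrite mulVf// gt_eqF.
Qed.

Lemma lel_anti n (A B : 'M[C]_n) : loewner_le A B -> loewner_le B A -> A = B.
Proof.
move=> AB BA; apply/eqP; rewrite eq_sym -subr_eq0; apply/eqP.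
rewrite -(fcalc_id (psd_ctmx AB)) (@eq_fcalc _ _ (fun=> 0)).
  by rewrite fcalc_cst raddf0.
move=> x xAB; apply/eqP; rewrite eq_le (spec_ge0 AB xAB) andbT.
have [v v1 e] := spec_form (psd_ctmx AB) xAB.
by have := BA.2 v; rewrite -opprB mulmxN mulNmx mxE e -rmorphN /= ge0_realcE oppr_ge0.
Qed.

(** Each eigenvalue is at most the sum of all of them. This converts convergence of entries into a
    Loewner bound. *)
Lemma psd_le_trace n (A : 'M[C]_n) : psdmx A ->
  loewner_le A ((complex.Re (\tr A))%:C)%:M.
Proof.
move=> pA; rewrite -{1}(fcalc_id (psd_ctmx pA)) -(fcalc_cst _ A).
apply: fcalc_le => _ [i <-].
set d := fun i => complex.Re (spectral_diag A 0 i); rewrite -/(d i).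
rewrite {1}(spectralE (psd_ctmx pA)) mxtrace_mulC mulmxA spectralKl mul1mx.
rewrite mxtrace_diag (_ : \sum_i _ = (\sum_i d i)%:C); last first.
  by rewrite rmorph_sum; apply: eq_bigr => j _; rewrite mxE.
rewrite /= (bigD1 i)//= lerDl sumr_ge0// => j _.
by apply: (spec_ge0 pA); exists j.
Qed.

End FunctionalCalculus.

(** * Jensen's operator inequality *)

Section Jensen.
Variable R : realType.
Local Notation C := R[i].

Lemma lel_scalar1 (a b : R) :
  loewner_le ((a%:C)%:M : 'M[C]_1) (b%:C)%:M -> a <= b.
Proof.
move=> [_ /(_ 1%:M)]; rewrite ctmx1 mul1mx mulmx1 !mxE !eqxx !mulr1n.
by rewrite subr_ge0 lecR.
Qed.

Lemma om_fcalc n (h : R -> R) (A B : 'M[C]_n) :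
  operator_monotone h -> pdmx A -> pdmx B -> loewner_le A B ->
  loewner_le (fcalc h A) (fcalc h B).
Proof. by rewrite -!mxfunE => hm; exact: hm. Qed.

Lemma om_le (h : R -> R) x y :
  operator_monotone h -> 0 < x -> x <= y -> h x <= h y.
Proof.
move=> hm x0 xy; apply: lel_scalar1; rewrite -!fcalc_scalar.
by apply: om_fcalc; [by []|exact: pd_scalar|apply: pd_scalar; lra|exact: lel_scalar].
Qed.

(* [S := T + s^-1 W T W] with [W := (1 + s) V V^* - 1] dominates [T] and maps
   the range of [V] into itself, so that [h(S)] can be computed there. *)
Lemma jensen_isometry_weak N n (h : R -> R) (T : 'M[C]_N) (V : 'M[C]_(N, n)) s :
  operator_monotone h -> pdmx T -> V^t* *m V = 1%:M -> 0 < s ->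
  loewner_le (V^t* *m fcalc h T *m V)
             (fcalc h ((1 + s)%:C *: (V^t* *m T *m V))).
Proof.
move=> hm pT hV s0.
pose W : 'M[C]_N := (1 + s)%:C *: (V *m V^t*) - 1%:M.
have hW : W^t* = W by rewrite /W ctmxB ctmxZ ctmx1 ctmxM trmxCK.
have psdW : psdmx ((s^-1)%:C *: (W *m T *m W)).
  apply: psdZ; first by rewrite invr_ge0 ltW.
  by rewrite -{1}hW; apply/psd_congr/pd_psd.
pose S : 'M[C]_N := T + (s^-1)%:C *: (W *m T *m W).
have pS : pdmx S by apply: pdD.
have TS : loewner_le T S by rewrite /loewner_le /S addrAC subrr add0r.
have pZ : pdmx (V^t* *m T *m V).
  by apply: pd_congr => // v e; rewrite -[v]mul1mx -hV -mulmxA e mulmx0.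
have hZ : ((1 + s)%:C *: (V^t* *m T *m V))^t* = (1 + s)%:C *: (V^t* *m T *m V).
  by rewrite ctmxZ (pd_ctmx pZ).
have WV : W *m V = s%:C *: V.
  rewrite /W mulmxBl mul1mx -scalemxAl -mulmxA hV mulmx1.
  by rewrite -[X in _ - X]scale1r -scalerBl -rmorphB /= addrAC subrr add0r.
have SV : S *m V = V *m ((1 + s)%:C *: (V^t* *m T *m V)).
  rewrite /S mulmxDl -scalemxAl -(mulmxA _ W V) WV -scalemxAr scalerA -rmorphM.
  rewrite mulVf ?gt_eqF// scale1r -(mulmxA W T V) /W mulmxBl mul1mx addrCA subrr.
  by rewrite addr0 -scalemxAl -scalemxAr !mulmxA.
have := lel_congr V (om_fcalc hm pT pS TS); clearbody S.
rewrite -(mulmxA (V^t*) (fcalc h S) V).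
rewrite (fcalc_intertwine h (pd_ctmx pS) hZ SV).
by rewrite (mulmxA (V^t*) V) hV mul1mx.
Qed.

Lemma ctmx_block m n (A : 'M[C]_m) (B : 'M[C]_n) :
  (block_mx A 0 0 B)^t* = block_mx (A^t*) 0 0 (B^t*).
Proof. by rewrite tr_block_mx !trmx0 map_block_mx !map_mx0. Qed.

Lemma pd_block m n (A : 'M[C]_m) (B : 'M[C]_n) :
  pdmx A -> pdmx B -> pdmx (block_mx A 0 0 B).
Proof.
move=> pA pB; split; first by apply/hermP; rewrite ctmx_block !pd_ctmx.
move=> v; rewrite -[v]vsubmxK; set a := usubmx v; set b := dsubmx v => ab0.
rewrite tr_col_mx map_row_mx mul_row_block !mulmx0 addr0 add0r mul_row_col mxE.
have [a0|a0] := eqVneq a 0.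
  rewrite a0 mulmx0 mxE add0r; apply: pB.2.
  by apply: contraNneq ab0 => b0; rewrite a0 b0 col_mx0.
by rewrite ltr_wpDr ?pA.2//; exact: (pd_psd pB).2.
Qed.

(** The inclusions of the two blocks intertwine the block matrix with [A] and with [B]. *)
Lemma fcalc_block m n (f : R -> R) (A : 'M[C]_m) (B : 'M[C]_n) :
  A^t* = A -> B^t* = B ->
  fcalc f (block_mx A 0 0 B) = block_mx (fcalc f A) 0 0 (fcalc f B).
Proof.
move=> hA hB; set T := block_mx A 0 0 B.
have hT : T^t* = T by rewrite ctmx_block hA hB.
have e1 : T *m col_mx 1%:M 0 = col_mx 1%:M 0 *m A.
  by rewrite mul_block_col mul_col_mx !mul0mx !mulmx0 mul1mx mulmx1 !addr0.
have e2 : T *m col_mx 0 1%:M = col_mx 0 1%:M *m B.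
  by rewrite mul_block_col mul_col_mx !mul0mx !mulmx0 mul1mx mulmx1 !add0r.
rewrite -[LHS]mulmx1 scalar_mx_block block_mxEh mul_mx_row.
rewrite (fcalc_intertwine f hT hA e1) (fcalc_intertwine f hT hB e2).
by rewrite block_mxEh !mul_col_mx !mul1mx !mul0mx.
Qed.

Section BinaryJensen.
Variables (n : nat) (h : R -> R) (A B U V : 'M[C]_n).
Hypotheses (hm : operator_monotone h) (pA : pdmx A) (pB : pdmx B).
Hypothesis UV1 : U^t* *m U + V^t* *m V = 1%:M.

Let ctmx_col : (col_mx U V)^t* = row_mx (U^t*) (V^t*).
Proof. by rewrite tr_col_mx map_row_mx. Qed.

Let col_isom : (col_mx U V)^t* *m col_mx U V = 1%:M.
Proof. by rewrite ctmx_col mul_row_col. Qed.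

Let col_congr (X Y : 'M[C]_n) :
  (col_mx U V)^t* *m block_mx X 0 0 Y *m col_mx U V =
  U^t* *m X *m U + V^t* *m Y *m V.
Proof.
by rewrite ctmx_col mul_row_block !mulmx0 addr0 add0r mul_row_col.
Qed.

Lemma pd_mean : pdmx (U^t* *m A *m U + V^t* *m B *m V).
Proof.
rewrite -col_congr; apply: pd_congr (pd_block pA pB) => v e.
by rewrite -[v]mul1mx -col_isom -mulmxA e mulmx0.
Qed.

(** By [UV1] the column [col_mx U V] is an isometry, so the isometry case applies to the block
    diagonal matrix of [A] and [B]. *)
Lemma jensen_weak s : 0 < s ->
  loewner_le (U^t* *m fcalc h A *m U + V^t* *m fcalc h B *m V)
             (fcalc h ((1 + s)%:C *: (U^t* *m A *m U + V^t* *m B *m V))).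
Proof.
move=> s0; rewrite -!col_congr -fcalc_block ?pd_ctmx//.
by apply: jensen_isometry_weak => //; exact: pd_block.
Qed.

End BinaryJensen.

Lemma ctmx_scale1 n (a : R) (A : 'M[C]_n) :
  ((a%:C)%:M : 'M[C]_n)^t* *m A *m (a%:C)%:M = (a ^+ 2)%:C *: A.
Proof.
by rewrite ctmx_scalar mul_scalar_mx mul_mx_scalar scalerA -rmorphM -expr2.
Qed.

Lemma scalar_mxZ n (a x : R) :
  a%:C *: ((x%:C)%:M : 'M[C]_n) = ((a * x)%:C)%:M.
Proof. by rewrite scale_scalar_mx; congr scalar_mx; rewrite rmorphM. Qed.

Lemma scalar_mxZD n (a x b y : R) :
  a%:C *: ((x%:C)%:M : 'M[C]_n) + b%:C *: (y%:C)%:M = ((a * x + b * y)%:C)%:M.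
Proof. by rewrite !scalar_mxZ -raddfD; congr scalar_mx; rewrite rmorphD. Qed.

Lemma sqrt_partition n t u : 0 <= t -> 0 <= u -> t + u = 1 ->
  (((Num.sqrt t)%:C)%:M : 'M[C]_n)^t* *m ((Num.sqrt t)%:C)%:M +
  (((Num.sqrt u)%:C)%:M : 'M[C]_n)^t* *m ((Num.sqrt u)%:C)%:M = 1%:M.
Proof.
move=> t0 u0 tu; rewrite -[X in X *m _ + _]mulmx1 -[X in _ + X *m _]mulmx1.
rewrite !ctmx_scale1 (sqr_sqrtr t0) (sqr_sqrtr u0) -scalerDl -rmorphD tu.
exact: scale1r.
Qed.

(** * Right continuity, and removal of the factor [1 + s] *)

Lemma om_concave1_weak (h : R -> R) x y t u s :
  operator_monotone h -> 0 < x -> 0 < y -> 0 <= t -> 0 <= u -> t + u = 1 ->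
  0 < s -> t * h x + u * h y <= h ((1 + s) * (t * x + u * y)).
Proof.
move=> hm x0 y0 t0 u0 tu s0; apply: lel_scalar1.
have := jensen_weak hm (pd_scalar 1 x0) (pd_scalar 1 y0) (sqrt_partition 1 t0 u0 tu) s0.
rewrite !ctmx_scale1 (sqr_sqrtr t0) (sqr_sqrtr u0) !fcalc_scalar.
by rewrite !scalar_mxZD scalar_mxZ fcalc_scalar.
Qed.

(** Weak concavity between [(1 + s) x] and [x / 2]. With weights [1 - 4 s] and [4 s], the resulting
    argument, including the extra factor [1 + s], is [(1 - 5 s^2 - 4 s^3) x], hence at most [x]. *)
Lemma om_right (h : R -> R) x s : operator_monotone h -> 0 < x ->
  0 < s -> s < 4^-1 ->
  (1 - 4 * s) * h ((1 + s) * x) + 4 * s * h (x / 2) <= h x.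
Proof.
move=> hm x0 s0 s4.
have t0 : 0 <= 1 - 4 * s by lra.
have u0 : 0 <= 4 * s by lra.
have x1 : 0 < (1 + s) * x by rewrite mulr_gt0//; lra.
have x2 : 0 < x / 2 by lra.
have := om_concave1_weak hm x1 x2 t0 u0 (subrK _ _) s0.
move=> /le_trans; apply; apply: om_le => //.
  apply: mulr_gt0; first by lra.
  by rewrite ltr_wpDl ?mulr_ge0 ?mulr_gt0 ?(ltW x1)//; lra.
rewrite -subr_ge0 (_ : _ - _ = (5 * s ^+ 2 + 4 * s ^+ 3) * x); last by field.
by rewrite mulr_ge0 ?ltW// addr_gt0// mulr_gt0// exprn_gt0.
Qed.

(** Uniform right continuity in multiplicative form, the only kind of continuity the limit arguments
    use. *)
Lemma om_right_unif (h : R -> R) a b e : operator_monotone h ->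
  0 < a -> a <= b -> 0 < e ->
  exists2 s, 0 < s & forall x, a <= x <= b -> h ((1 + s) * x) <= h x + e.
Proof.
move=> hm a0 ab e0; pose L := h (2 * b) - h (a / 2).
have L0 : 0 <= L by rewrite subr_ge0; apply: om_le => //; lra.
have eL : 0 < e + L by lra.
(* [L] bounds the oscillation of [h] over [[a / 2, 2 b]]. This [s] gives [4 s L <= e] and
   [s <= 1/8], so [(1 + s) x] stays below [2 b]; [e + L] is positive even when [L = 0]. *)
pose s := e / (e + L) / 8.
have s0 : 0 < s by rewrite /s !divr_gt0.
have s1 : e / (e + L) <= 1 by rewrite ler_pdivrMr// mul1r; lra.
have sL : 4 * s * L <= e.
  rewrite -subr_ge0 (_ : _ - _ = e * (2 * e + L) / (2 * (e + L))).
    by rewrite divr_ge0// ?mulr_ge0//; lra.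
  by rewrite /s; field; rewrite gt_eqF.
exists s => // x /andP[ax xb].
have s8 : s <= 8^-1 by rewrite /s; lra.
have x0 : 0 < x by lra.
have := om_right hm x0 s0 ltac:(lra).
have h1 : h ((1 + s) * x) <= h (2 * b).
  apply: om_le => //; first by rewrite mulr_gt0//; lra.
  by apply: ler_pM; lra.
have h2 : h (a / 2) <= h (x / 2) by apply: om_le => //; lra.
have : 4 * s * (h ((1 + s) * x) - h (x / 2)) <= 4 * s * L.
  by rewrite ler_wpM2l /L//; lra.
lra.
Qed.

(** The factor [1 + s] of the weak form costs at most [e] on an interval containing the spectrum of
    the mean, and [e] is arbitrary. *)
Lemma jensen n (h : R -> R) (A B U V : 'M[C]_n) :
  operator_monotone h -> pdmx A -> pdmx B ->
  U^t* *m U + V^t* *m V = 1%:M ->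
  loewner_le (U^t* *m fcalc h A *m U + V^t* *m fcalc h B *m V)
             (fcalc h (U^t* *m A *m U + V^t* *m B *m V)).
Proof.
move=> hm pA pB UV1; apply: (lel_ext (pd_psd (pd1 R n))) => e e0.
have pZ := pd_mean pA pB UV1.
have [a [b [a0 ab hab]]] := spec_bounds pZ.
have [s s0 hs] := om_right_unif hm a0 ab e0.
apply: lel_trans (jensen_weak hm pA pB UV1 s0) _.
rewrite (fcalc_scale _ _ (pd_ctmx pZ)) scalemx1.
rewrite -(fcalc_cst e (U^t* *m A *m U + V^t* *m B *m V)) -fcalcD.
by apply: fcalc_le => x /hab; exact: hs.
Qed.

Lemma om_concave n (h : R -> R) (A B : 'M[C]_n) t u :
  operator_monotone h -> pdmx A -> pdmx B -> 0 <= t -> 0 <= u -> t + u = 1 ->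
  loewner_le (t%:C *: fcalc h A + u%:C *: fcalc h B)
             (fcalc h (t%:C *: A + u%:C *: B)).
Proof.
move=> hm pA pB t0 u0 tu.
have := jensen hm pA pB (sqrt_partition n t0 u0 tu).
by rewrite !ctmx_scale1 (sqr_sqrtr t0) (sqr_sqrtr u0).
Qed.

Lemma om_concave1 (h : R -> R) x y t u :
  operator_monotone h -> 0 < x -> 0 < y -> 0 <= t -> 0 <= u -> t + u = 1 ->
  t * h x + u * h y <= h (t * x + u * y).
Proof.
move=> hm x0 y0 t0 u0 tu; apply: lel_scalar1.
have := om_concave hm (pd_scalar 1 x0) (pd_scalar 1 y0) t0 u0 tu.
by rewrite !fcalc_scalar !scalar_mxZD fcalc_scalar.
Qed.

Lemma pd_wsum n k (w : 'I_n -> R) (A : 'I_n -> 'M[C]_k) :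
  weight_vector w -> (forall i, pdmx (A i)) -> pdmx (\sum_i (w i)%:C *: A i).
Proof.
case: n w A => [|n] w A [w0 w1] pA.
  by move: w1; rewrite big_ord0 => /esym/eqP; rewrite oner_eq0.
rewrite big_ord_recl; apply: pdD; first exact: pdZ.
by apply: psd_sum => i; apply/psdZ/pd_psd => //; exact/ltW.
Qed.

Lemma om_concave_sum n k (h : R -> R) (w : 'I_n -> R) (A : 'I_n -> 'M[C]_k) :
  operator_monotone h -> weight_vector w -> (forall i, pdmx (A i)) ->
  loewner_le (\sum_i (w i)%:C *: fcalc h (A i))
             (fcalc h (\sum_i (w i)%:C *: A i)).
Proof.
move=> hm; elim: n w A => [|n IH] w A [w0 w1] pA.
  by move: w1; rewrite big_ord0 => /esym/eqP; rewrite oner_eq0.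
(* With an empty tail the remaining weight [1 - t] is zero and cannot be normalised. *)
have [n0|n0] := posnP n.
  subst n; move: w1; rewrite !big_ord1 => ->; rewrite !scale1r; exact: lel_refl.
rewrite !big_ord_recl; set t := w ord0.
have wt : \sum_(i < n) w (lift ord0 i) = 1 - t by rewrite -w1 big_ord_recl addrC addKr.
have t1 : 0 < 1 - t.
  rewrite -wt; case: n n0 {IH} w A w0 w1 pA @t wt => // n _ w A w0 w1 pA t wt.
  by rewrite big_ord_recl ltr_wpDr// sumr_ge0// => i _; exact/ltW.
pose v i := w (lift ord0 i) / (1 - t).
have wv : weight_vector v.
  split=> [i|]; first by rewrite /v divr_gt0// w0.
  by rewrite -mulr_suml wt divff// gt_eqF.
have ve (B : 'I_n -> 'M[C]_k) : \sum_i (w (lift ord0 i))%:C *: B i =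
    (1 - t)%:C *: \sum_i (v i)%:C *: B i.
  rewrite scaler_sumr; apply: eq_bigr => i _; rewrite scalerA -rmorphM /=.
  by rewrite /v mulrC divfK// gt_eqF.
rewrite !ve.
have pS := pd_wsum wv (fun i => pA (lift ord0 i)).
have t0 : 0 <= t := ltW (w0 ord0).
apply: lel_trans (om_concave hm (pA ord0) pS t0 (ltW t1) (subrKC _ _)).
apply: lelD; first exact: lel_refl.
by apply: lelZ (ltW t1) _; exact: (IH v (fun i => A (lift ord0 i)) wv).
Qed.

End Jensen.

(** * Perspectives of operator monotone functions *)

(* Sealed for the same reason as [fcalc]. *)
HB.lock Definition rtmx (R : realType) n (X : 'M[R[i]]_n) : 'M[R[i]]_n :=
  fcalc Num.sqrt X.
HB.lock Definition irtmx (R : realType) n (X : 'M[R[i]]_n) : 'M[R[i]]_n :=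
  fcalc (fun x => (Num.sqrt x)^-1) X.
HB.lock Definition relmx (R : realType) n (X A : 'M[R[i]]_n) : 'M[R[i]]_n :=
  irtmx X *m A *m irtmx X.
HB.lock Definition unrelmx (R : realType) n (X B : 'M[R[i]]_n) : 'M[R[i]]_n :=
  rtmx X *m B *m rtmx X.

Section Perspective.
Local Open Scope classical_set_scope.
Variable R : realType.
Local Notation C := R[i].

(** * Inversion, and the tangent bounds at 1 *)

Lemma fcalcV n (A : 'M[C]_n) : pdmx A -> A *m fcalc GRing.inv A = 1%:M.
Proof. by move=> pA; apply/mulmx1C/fcalc_inv. Qed.

(** With [A'] and [B'] the inverses, [A' - B' = B' (B - A) B' + (A' - B') A (A' - B')], a sum of two
    positive semidefinite terms. *)
Lemma inv_antitone n (A B : 'M[C]_n) : pdmx A -> pdmx B -> loewner_le A B ->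
  loewner_le (fcalc GRing.inv B) (fcalc GRing.inv A).
Proof.
move=> pA pB AB.
have := fcalc_inv pA; have := fcalcV pA; have := fcalc_inv pB.
have := fcalc_ctmx GRing.inv A; have := fcalc_ctmx GRing.inv B.
move: (fcalc GRing.inv A) (fcalc GRing.inv B) => A' B' hB' hA' bB aA Aa.
have hD : (A' - B')^t* = A' - B' by rewrite ctmxB hA' hB'.
rewrite /loewner_le (_ : A' - B' =
  B'^t* *m (B - A) *m B' + (A' - B')^t* *m A *m (A' - B')); last first.
  rewrite hD hB' mulmxBr bB mulmxBl mul1mx.
  rewrite mulmxBl Aa mulmxBl mul1mx mulmxBr -(mulmxA B' A A') aA mulmx1.
  by rewrite [RHS]addrC subrK.
exact: psdD (psd_congr _ AB) (psd_congr _ (pd_psd pA)).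
Qed.

(** The sign and the inversion each reverse the order. This duality turns the upper tangent bound
    into the lower one. *)
Lemma om_dual (g : R -> R) : operator_monotone g ->
  operator_monotone (fun x => - g x^-1).
Proof.
move=> hg n A B pA pB AB; rewrite !mxfunE.
have E (X : 'M[C]_n) : fcalc (fun x => - g x^-1) X = - fcalc g (fcalc GRing.inv X).
  rewrite fcalc_comp -scaleN1r -(rmorphN1 (real_complex R)) -fcalcZ.
  by apply: eq_fcalc => x _ /=; rewrite mulN1r.
rewrite !E /loewner_le opprK addrC; apply: (om_fcalc hg).
- by apply: pd_fcalc => x /(spec_gt0 pB); rewrite invr_gt0.
- by apply: pd_fcalc => x /(spec_gt0 pA); rewrite invr_gt0.
- exact: inv_antitone.
Qed.

(** A concave function lies below its tangent: with [u = x - 1], concavity gives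
    [t * g x <= g (1 + t * u)], and the difference quotient at [t * u] is close to 1. *)
Lemma om_le_tangent (g : R -> R) x : operator_monotone g -> g 1 = 0 ->
  is_derive (1 : R) (1 : R) g (1 : R) -> 0 < x -> g x <= x - 1.
Proof.
move=> gm g1 dg x0; apply/ler_addgt0Pr => e e0.
have dcv : (fun h : R => h^-1 *: (g (h *: 1 + 1) - g 1)) @ 0^' --> (1 : R).
  have := @ex_derive _ _ _ _ _ _ _ dg.
  by rewrite /derivable -[X in _ --> X -> _]/('D_1 g 1) derive_val.
have d0 : 0 < e / (`|x - 1| + 1) by rewrite divr_gt0// ltr_wpDl.
move/cvgrPdist_lt: dcv => /(_ _ d0) [r /= r0 hr].
pose u := x - 1.
(* At most 1, to serve as a convex weight, and small enough for [1 + t * u] to lie within [r] of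
   1. *)
pose t := Num.min 1 (r / 2 / (`|u| + 1)).
have t0 : 0 < t by rewrite lt_min ltr01/= !divr_gt0// ltr_wpDl.
have t1 : t <= 1 by rewrite ge_min lexx.
have tu : `|t * u| < r.
  have : t * (`|u| + 1) <= r / 2.
    by rewrite -ler_pdivlMr ?ltr_wpDl// ge_min lexx orbT.
  rewrite normrM (gtr0_norm t0); nra.
have [u0|u0] := eqVneq u 0.
  have -> : x = 1 by rewrite /u in u0; lra.
  by rewrite g1 subrr add0r ltW.
have := hr (t * u). rewrite /ball_/= sub0r normrN => /(_ tu).
have tu0 : t * u != 0 by rewrite mulf_neq0// gt_eqF.
move=> /(_ tu0); rewrite g1 subr0 /GRing.scale/= mulr1.
set q := (t * u)^-1 * _ => hq.
have gq : g (t * u + 1) = t * (u * q) by rewrite mulrA /q mulrA mulfV// mul1r.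
have := om_concave1 gm x0 ltr01 (ltW t0) (_ : 0 <= 1 - t) (subrKC _ _).
rewrite g1 mulr0 addr0 (_ : t * x + (1 - t) * 1 = t * u + 1); last by rewrite /u; ring.
rewrite gq subr_ge0 ler_pM2l// => /(_ t1) /le_trans; apply.
have : `|u * (q - 1)| <= e.
  rewrite normrM (distrC q 1); move: hq; rewrite ltr_pdivlMr ?ltr_wpDl// -/u.
  have := normr_ge0 u; have := normr_ge0 (1 - q); nra.
by rewrite ler_norml -/u => /andP[_]; lra.
Qed.
(** The tangent bound for the dual function [x |-> - g x^-1], taken at [x^-1]. *)
Lemma om_ge_cotangent (g : R -> R) x : operator_monotone g -> g 1 = 0 ->
  is_derive (1 : R) (1 : R) g (1 : R) -> 0 < x -> 1 - x^-1 <= g x.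
Proof.
move=> gm g1 dg x0.
have dV : is_derive (1 : R) (1 : R) (fun x : R => x^-1) (-1).
  have := @is_deriveV R id 1 1 1 (oner_neq0 _) (is_derive_id (1 : R) (1 : R)).
  by rewrite /= expr1n invr1 scaleN1r.
have dg' : is_derive (1 : R) (1 : R) (fun x => - g x^-1) (1 : R).
  have dg1 : is_derive ((1 : R)^-1) (1 : R) g (1 : R) by rewrite invr1.
  have := is_deriveN (is_derive1_comp dg1 dV).
  by rewrite mulrN1 opprK.
have := om_le_tangent (om_dual gm) _ dg' (_ : 0 < x^-1).
by rewrite invr1 g1 oppr0 invrK invr_gt0 => /(_ erefl x0); lra.
Qed.

(** * Congruence by square roots, and perspectives *)

Lemma rtmxE n (X : 'M[C]_n) : rtmx X = fcalc Num.sqrt X.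
Proof. by rewrite rtmx.unlock. Qed.

Lemma irtmxE n (X : 'M[C]_n) : irtmx X = fcalc (fun x => (Num.sqrt x)^-1) X.
Proof. by rewrite irtmx.unlock. Qed.

Lemma relmxE n (X A : 'M[C]_n) : relmx X A = irtmx X *m A *m irtmx X.
Proof. by rewrite relmx.unlock. Qed.

Lemma unrelmxE n (X B : 'M[C]_n) : unrelmx X B = rtmx X *m B *m rtmx X.
Proof. by rewrite unrelmx.unlock. Qed.

Lemma rtmx_ctmx n (X : 'M[C]_n) : (rtmx X)^t* = rtmx X.
Proof. by rewrite rtmxE fcalc_ctmx. Qed.

Lemma irtmx_ctmx n (X : 'M[C]_n) : (irtmx X)^t* = irtmx X.
Proof. by rewrite irtmxE fcalc_ctmx. Qed.

Lemma rtmxM n (X : 'M[C]_n) : psdmx X -> rtmx X *m rtmx X = X.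
Proof.
move=> pX; rewrite !rtmxE -fcalcM -[RHS](fcalc_id (psd_ctmx pX)).
by apply: eq_fcalc => x /(spec_ge0 pX) x0; rewrite -expr2 sqr_sqrtr.
Qed.

Lemma rtmxK n (X : 'M[C]_n) : pdmx X -> rtmx X *m irtmx X = 1%:M.
Proof.
move=> pX; rewrite rtmxE irtmxE -fcalcM (@eq_fcalc _ _ _ (fun=> 1)) ?fcalc_cst//.
by move=> x /(spec_gt0 pX) x0; rewrite divff// gt_eqF// sqrtr_gt0.
Qed.

Lemma irtmxK n (X : 'M[C]_n) : pdmx X -> irtmx X *m rtmx X = 1%:M.
Proof. by move=> /rtmxK/mulmx1C. Qed.

Lemma relmx_self n (X : 'M[C]_n) : pdmx X -> relmx X X = 1%:M.
Proof.
move=> pX; rewrite relmxE -{2}(rtmxM (pd_psd pX)) !mulmxA irtmxK//.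
by rewrite mul1mx rtmxK.
Qed.

Lemma relmx_le n (X A B : 'M[C]_n) : loewner_le A B ->
  loewner_le (relmx X A) (relmx X B).
Proof. by rewrite !relmxE => /(lel_congr (irtmx X)); rewrite irtmx_ctmx. Qed.

Lemma relmx_psd n (X A : 'M[C]_n) : psdmx A -> psdmx (relmx X A).
Proof. by rewrite relmxE => /(psd_congr (irtmx X)); rewrite irtmx_ctmx. Qed.

Lemma relmx_pd n (X A : 'M[C]_n) : pdmx X -> pdmx A -> pdmx (relmx X A).
Proof.
move=> pX pA; rewrite relmxE -{1}irtmx_ctmx; apply: pd_congr => // v e.
by rewrite -[v]mul1mx -(rtmxK pX) -mulmxA e mulmx0.
Qed.

Lemma relmxD n (X A B : 'M[C]_n) : relmx X (A + B) = relmx X A + relmx X B.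
Proof. by rewrite !relmxE mulmxDr mulmxDl. Qed.

Lemma relmxZ n (a : R) (X A : 'M[C]_n) : relmx X (a%:C *: A) = a%:C *: relmx X A.
Proof. by rewrite !relmxE -scalemxAr -scalemxAl. Qed.

Lemma relmx_le_scalar n (a : R) (X A : 'M[C]_n) : pdmx X ->
  loewner_le A (a%:C *: X) -> loewner_le (relmx X A) (a%:C)%:M.
Proof. by move=> pX /(relmx_le X); rewrite relmxZ (relmx_self pX) scalemx1. Qed.

Lemma relmx_ge_scalar n (a : R) (X A : 'M[C]_n) : pdmx X ->
  loewner_le (a%:C *: X) A -> loewner_le (a%:C)%:M (relmx X A).
Proof. by move=> pX /(relmx_le X); rewrite relmxZ (relmx_self pX) scalemx1. Qed.

Lemma relmx_spec n (a b x : R) (X A : 'M[C]_n) : pdmx X -> pdmx A ->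
  loewner_le (a%:C *: X) A -> loewner_le A (b%:C *: X) ->
  spec (relmx X A) x -> a <= x <= b.
Proof.
move=> pX pA aA Ab xA; have pB := pd_ctmx (relmx_pd pX pA).
by rewrite (spec_ge pB (relmx_ge_scalar pX aA) xA)
           (spec_le pB (relmx_le_scalar pX Ab) xA).
Qed.

Lemma unrelmx_le n (X A B : 'M[C]_n) : loewner_le A B ->
  loewner_le (unrelmx X A) (unrelmx X B).
Proof. by rewrite !unrelmxE => /(lel_congr (rtmx X)); rewrite rtmx_ctmx. Qed.

Lemma unrelmxD n (X A B : 'M[C]_n) : unrelmx X (A + B) = unrelmx X A + unrelmx X B.
Proof. by rewrite !unrelmxE mulmxDr mulmxDl. Qed.

Lemma unrelmxZ n (a : R) (X A : 'M[C]_n) : unrelmx X (a%:C *: A) = a%:C *: unrelmx X A.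
Proof. by rewrite !unrelmxE -scalemxAr -scalemxAl. Qed.

Lemma unrelmx_scalar n (a : R) (X : 'M[C]_n) : psdmx X ->
  unrelmx X (a%:C)%:M = a%:C *: X.
Proof. by move=> pX; rewrite -scalemx1 unrelmxZ unrelmxE mulmx1 rtmxM. Qed.

Lemma relmxK n (X A : 'M[C]_n) : pdmx X -> unrelmx X (relmx X A) = A.
Proof.
move=> pX; rewrite unrelmxE relmxE !mulmxA rtmxK// mul1mx.
by rewrite -mulmxA irtmxK// mulmx1.
Qed.

Lemma unrelmxK n (X A : 'M[C]_n) : pdmx X -> relmx X (unrelmx X A) = A.
Proof.
move=> pX; rewrite unrelmxE relmxE !mulmxA irtmxK// mul1mx.
by rewrite -mulmxA rtmxK// mulmx1.
Qed.

(** The noncommutative perspective of [h]; for positive operator monotone [h] with [h 1 = 1] it is a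
    Kubo-Ando mean of [X] and [A]. *)
Definition persp n (h : R -> R) (X A : 'M[C]_n) : 'M[C]_n :=
  unrelmx X (fcalc h (relmx X A)).

Lemma persp_affine n (a b : R) (h : R -> R) (X A : 'M[C]_n) : psdmx X ->
  persp (fun x => a * h x + b) X A = a%:C *: persp h X A + b%:C *: X.
Proof.
by move=> pX; rewrite /persp fcalcD fcalcZ fcalc_cst unrelmxD unrelmxZ unrelmx_scalar.
Qed.

Lemma persp_le_fun n (f h : R -> R) (X A : 'M[C]_n) : pdmx X -> pdmx A ->
  (forall x, 0 < x -> f x <= h x) -> loewner_le (persp f X A) (persp h X A).
Proof.
move=> pX pA fh; apply/unrelmx_le/fcalc_le => x /(spec_gt0 (relmx_pd pX pA)).
exact: fh.
Qed.

Lemma persp_le_near n (a b e : R) (f h : R -> R) (X A : 'M[C]_n) :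
  pdmx X -> pdmx A -> loewner_le (a%:C *: X) A -> loewner_le A (b%:C *: X) ->
  (forall x, a <= x <= b -> f x <= h x + e) ->
  loewner_le (persp f X A) (persp h X A + e%:C *: X).
Proof.
move=> pX pA aA Ab fh; rewrite -(unrelmx_scalar e (pd_psd pX)) -unrelmxD.
rewrite -(fcalc_cst e (relmx X A)) -fcalcD; apply/unrelmx_le/fcalc_le => x.
by move=> /(relmx_spec pX pA aA Ab); exact: fh.
Qed.

Lemma persp_le_self n (h : R -> R) (X A : 'M[C]_n) :
  operator_monotone h -> pdmx X -> pdmx A -> loewner_le A X ->
  loewner_le (persp h X A) ((h 1)%:C *: X).
Proof.
move=> hm pX pA AX; rewrite -(unrelmx_scalar _ (pd_psd pX)).
apply: unrelmx_le; rewrite -(fcalc_scalar n 1 h).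
apply: (om_fcalc hm (relmx_pd pX pA) (pd_scalar n ltr01)).
by apply: (relmx_le_scalar pX); rewrite scale1r.
Qed.

Lemma persp_ge_self n (h : R -> R) (X A : 'M[C]_n) :
  operator_monotone h -> pdmx X -> pdmx A -> loewner_le X A ->
  loewner_le ((h 1)%:C *: X) (persp h X A).
Proof.
move=> hm pX pA AX; rewrite -(unrelmx_scalar _ (pd_psd pX)).
apply: unrelmx_le; rewrite -(fcalc_scalar n 1 h).
apply: (om_fcalc hm (pd_scalar n ltr01) (relmx_pd pX pA)).
by apply: (relmx_ge_scalar pX); rewrite scale1r.
Qed.

Lemma persp_scale n (h : R -> R) (t : R) (X A : 'M[C]_n) : 0 < t ->
  pdmx X -> pdmx A ->
  persp h (t%:C *: X) A = t%:C *: persp (fun x => h (t^-1 * x)) X A.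
Proof.
move=> t0 pX pA.
have s0 : 0 < Num.sqrt t by rewrite sqrtr_gt0.
have e1 : rtmx (t%:C *: X) = (Num.sqrt t)%:C *: rtmx X.
  rewrite !rtmxE (fcalc_scale _ _ (pd_ctmx pX)) -fcalcZ; apply: eq_fcalc => x _.
  by rewrite sqrtrM// ltW.
have e2 : irtmx (t%:C *: X) = ((Num.sqrt t)^-1)%:C *: irtmx X.
  rewrite !irtmxE (fcalc_scale _ _ (pd_ctmx pX)) -fcalcZ; apply: eq_fcalc => x _.
  by rewrite sqrtrM ?invfM// ltW.
have sst : Num.sqrt t * Num.sqrt t = t by rewrite -expr2 sqr_sqrtr// ltW.
have e3 : relmx (t%:C *: X) A = (t^-1)%:C *: relmx X A.
  rewrite !relmxE e2 -!scalemxAl -!scalemxAr scalerA -rmorphM /=.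
  by rewrite -invfM sst.
rewrite /persp e3 fcalc_scale ?(pd_ctmx (relmx_pd pX pA))//.
by rewrite !unrelmxE e1 -!scalemxAl -!scalemxAr scalerA -rmorphM /= sst.
Qed.

Lemma persp_scale_le n (h : R -> R) (t : R) (X A : 'M[C]_n) :
  operator_monotone h -> 1 <= t -> pdmx X -> pdmx A ->
  loewner_le (persp h (t%:C *: X) A) (t%:C *: persp h X A).
Proof.
move=> hm t1 pX pA; have t0 : 0 < t by lra.
rewrite persp_scale//; apply: lelZ; first exact: ltW.
apply: persp_le_fun => // x x0; apply: om_le => //.
  by rewrite mulr_gt0// invr_gt0.
by apply: ler_piMl; [exact: ltW|rewrite invf_le1].
Qed.

(* Jensen's inequality for [U := X^(1/2) Y^(-1/2)] and
   [V := (Y^(-1/2) (Y - X) Y^(-1/2))^(1/2)], which satisfy [U^* U + V^* V = 1]. *)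
Lemma persp_superadd n (h : R -> R) (e : R) (X Y A : 'M[C]_n) :
  operator_monotone h -> 0 < e -> pdmx X -> pdmx Y -> pdmx A ->
  loewner_le X Y ->
  loewner_le (persp h X A + (h e)%:C *: (Y - X))
             (unrelmx Y (fcalc h (relmx Y A + e%:C *: relmx Y (Y - X)))).
Proof.
move=> hm e0 pX pY pA XY.
have psE := relmx_psd Y XY.
pose U : 'M[C]_n := rtmx X *m irtmx Y.
pose V : 'M[C]_n := rtmx (relmx Y (Y - X)).
have hU : U^t* = irtmx Y *m rtmx X by rewrite ctmxM rtmx_ctmx irtmx_ctmx.
have VV (a : R) : V^t* *m (a%:C)%:M *m V = a%:C *: relmx Y (Y - X).
  by rewrite mul_mx_scalar -scalemxAl rtmx_ctmx rtmxM.
have UU : U^t* *m U = relmx Y X.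
  by rewrite hU /U relmxE !mulmxA -(mulmxA _ (rtmx X) (rtmx X)) (rtmxM (pd_psd pX)).
have UV1 : U^t* *m U + V^t* *m V = 1%:M.
  rewrite UU -[X in _ + X *m _]mulmx1 -[1%:M](_ : (1%:C)%:M = _)// VV scale1r.
  by rewrite -relmxD addrC subrK relmx_self.
have eA : U^t* *m relmx X A *m U = relmx Y A.
  rewrite hU /U !relmxE !mulmxA.
  rewrite -(mulmxA (irtmx Y) (rtmx X) (irtmx X)) (rtmxK pX) mulmx1.
  by rewrite -(mulmxA _ (irtmx X) (rtmx X)) (irtmxK pX) mulmx1.
have eP : unrelmx Y (U^t* *m fcalc h (relmx X A) *m U) = persp h X A.
  rewrite hU /U /persp !unrelmxE !mulmxA (rtmxK pY) mul1mx.
  by rewrite -(mulmxA _ (irtmx Y) (rtmx Y)) (irtmxK pY) mulmx1.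
have := jensen hm (relmx_pd pX pA) (pd_scalar n e0) UV1.
rewrite fcalc_scalar !VV eA => /(unrelmx_le Y).
by rewrite unrelmxD unrelmxZ eP (relmxK _ pY).
Qed.

(** In [persp_superadd] the term [h e (Y - X)] is nonnegative and may be dropped; the price is a
    small shift of the argument of [h], absorbed by right continuity. *)
Lemma persp_le n (h : R -> R) (X Y A : 'M[C]_n) :
  operator_monotone h -> (forall x, 0 < x -> 0 <= h x) ->
  pdmx X -> pdmx Y -> pdmx A -> loewner_le X Y ->
  loewner_le (persp h X A) (persp h Y A).
Proof.
move=> hm h0 pX pY pA XY; apply: (lel_ext (pd_psd pY)) => e e0.
have pB := relmx_pd pY pA.
have [a [b [a0 ab hab]]] := spec_bounds pB.
have [s s0 hs] := om_right_unif hm a0 ab e0.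
(* The shift is at most [s * a], hence at most [s * x] at each spectral point [x >= a], which fits
   the form [(1 + s) x]. *)
have sa0 : 0 < s * a by rewrite mulr_gt0.
apply: (@lel_trans _ _ (persp h X A + (h (s * a))%:C *: (Y - X))).
  by rewrite /loewner_le addrC addKr; apply: psdZ => //; exact: h0.
apply: lel_trans (persp_superadd hm sa0 pX pY pA XY) _.
rewrite -(unrelmx_scalar e (pd_psd pY)) -unrelmxD.
apply: unrelmx_le; rewrite -(fcalc_cst e (relmx Y A)) -fcalcD.
have pE : psdmx ((s * a)%:C *: relmx Y (Y - X)).
  exact: psdZ (ltW sa0) (relmx_psd Y XY).
have pE1 := pd_psd (pd_scalar n sa0).
apply: (@lel_trans _ _ (fcalc h (relmx Y A + (s * a)%:C%:M))).
  apply: (om_fcalc hm (pdD pB pE) (pdD pB pE1)).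
  apply: lelD; first exact: lel_refl.
  rewrite -relmxZ; apply: (relmx_le_scalar pY); apply: lelZ; first exact: ltW.
  by rewrite /loewner_le opprB addrC subrK; exact: pd_psd.
have -> : relmx Y A + (s * a)%:C%:M = fcalc (fun x => 1 * x + s * a) (relmx Y A).
  by rewrite fcalc_affine ?scale1r// pd_ctmx.
rewrite fcalc_comp; apply: fcalc_le => x xB /=.
have /andP[ax xb] := hab _ xB.
apply: le_trans (hs x _); last by rewrite ax.
apply: om_le => //; first by rewrite mul1r addr_gt0//; lra.
by rewrite mulrDl lerD2l ler_pM2l.
Qed.

(** A substitute for [persp_le] when [g] takes negative values: superadditivity is applied at the
    point 1, where [g 1 = 0] removes the extra term, and [Y - X <= d X <= d Y] keeps the shift
    small. The constant [d] is uniform in the matrices. *)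
Lemma persp_lsc (g : R -> R) (r e : R) : operator_monotone g -> g 1 = 0 ->
  0 < r -> r <= r^-1 -> 0 < e ->
  exists2 d, 0 < d & forall n (X Y A : 'M[C]_n),
    pdmx X -> pdmx Y -> pdmx A ->
    loewner_le X Y -> loewner_le Y ((1 + d)%:C *: X) ->
    loewner_le (r%:C *: Y) A -> loewner_le A ((r^-1)%:C *: Y) ->
    loewner_le (persp g X A) (persp g Y A + e%:C *: Y).
Proof.
move=> gm g1 r0 r1 e0; have [s s0 hs] := om_right_unif gm r0 r1 e0.
have sr : 0 < s * r by rewrite mulr_gt0.
exists (s * r); first exact: sr.
move=> n X Y A pX pY pA XY YX rA Ar.
have := persp_superadd gm ltr01 pX pY pA XY.
rewrite g1 scale0r addr0 scale1r => /lel_trans; apply.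
rewrite -(unrelmx_scalar e (pd_psd pY)) -unrelmxD.
apply: unrelmx_le; rewrite -(fcalc_cst e (relmx Y A)) -fcalcD.
have pB := relmx_pd pY pA.
apply: (@lel_trans _ _ (fcalc g (relmx Y A + (s * r)%:C%:M))).
  apply: (om_fcalc gm (pdD pB (relmx_psd Y XY)) (pdD pB (pd_psd (pd_scalar n sr)))).
  apply: lelD; first exact: lel_refl.
  apply: (relmx_le_scalar pY).
  apply: (lel_trans _ (lelZ (ltW sr) XY)).
  by move: YX; rewrite /loewner_le rmorphD scalerDl scale1r opprB addrCA addrA.
have -> : relmx Y A + (s * r)%:C%:M = fcalc (fun x => 1 * x + s * r) (relmx Y A).
  by rewrite fcalc_affine ?scale1r// pd_ctmx.
rewrite fcalc_comp; apply: fcalc_le => x xB /=.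
have /andP[rx xr] := relmx_spec pY pA rA Ar xB.
apply: le_trans (hs x _); last by rewrite rx.
apply: om_le => //; first by rewrite mul1r addr_gt0//; lra.
by rewrite mulrDl lerD2l ler_pM2l.
Qed.

End Perspective.

(** * Limits of decreasing sequences of matrices *)

Section MonotoneLimit.
Local Open Scope classical_set_scope.
Variable R : realType.
Local Notation C := R[i].
Local Notation Re := (@complex.Re R).
Local Notation Im := (@complex.Im R).

Lemma Re_sum (I : finType) (F : I -> C) : Re (\sum_i F i) = \sum_i Re (F i).
Proof.
by apply: (big_morph (@complex.Re R)) => // -[a b] [c d].
Qed.

Lemma ReM (x y : C) : Re (x * y) = Re x * Re y - Im x * Im y.
Proof. by case: x y => [a b] [c d]. Qed.

Lemma psd_Re n (A : 'M[C]_n) : A^t* = A ->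
  (forall v : 'cV[C]_n, 0 <= Re ((v^t* *m A *m v) 0 0)) -> psdmx A.
Proof.
move=> hA h; split=> [|v]; first exact/hermP.
have := congr1 (fun B : 'M[C]_1 => B 0 0) (ctmx_congr v hA).
have := h v; rewrite [X in X = _ -> _]mxE [X in _ X = _ -> _]mxE.
case: ((v^t* *m A *m v) 0 0) => x y /= x0 [yy].
by rewrite lecE /= x0 andbT; apply/eqP; lra.
Qed.

(** The form is a fixed real linear combination of real and imaginary parts of entries, so
    convergence of entries passes to it. *)
Lemma Re_form n (A : 'M[C]_n) (u v : 'cV[C]_n) :
  Re ((u^t* *m A *m v) 0 0) =
  \sum_j \sum_i (Re ((u i 0)^* * v j 0) * Re (A i j)
               - Im ((u i 0)^* * v j 0) * Im (A i j)).
Proof.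
rewrite mxE Re_sum; apply: eq_bigr => j _; rewrite mxE mulr_suml Re_sum.
by apply: eq_bigr => i _; rewrite !mxE -ReM mulrAC.
Qed.

Lemma Remx11D (A B : 'M[C]_1) : Re ((A + B) 0 0) = Re (A 0 0) + Re (B 0 0).
Proof. by rewrite mxE; case: (A 0 0) (B 0 0) => [a b] [c d]. Qed.

Lemma Remx11N (A : 'M[C]_1) : Re ((- A) 0 0) = - Re (A 0 0).
Proof. by rewrite mxE; case: (A 0 0). Qed.

(** Polarisation: the real part of a Hermitian form is symmetric and biadditive, so two terms
    suffice. Convergence of quadratic forms thus gives convergence of entries. *)
Lemma Re_form_polar n (A : 'M[C]_n) (u v : 'cV[C]_n) : A^t* = A ->
  Re ((u^t* *m A *m v) 0 0) = 4^-1 *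
   (Re (((u + v)^t* *m A *m (u + v)) 0 0) - Re (((u - v)^t* *m A *m (u - v)) 0 0)).
Proof.
move=> hA; pose B (x y : 'cV[C]_n) := Re ((x^t* *m A *m y) 0 0).
have BC x y : B x y = B y x.
  rewrite /B; have <- : (x^t* *m A *m y)^t* = y^t* *m A *m x.
    by rewrite !ctmxM trmxCK hA mulmxA.
  by rewrite [in RHS]mxE [in RHS]mxE; case: ((x^t* *m A *m y) 0 0).
have BD x y z : B x (y + z) = B x y + B x z by rewrite /B mulmxDr Remx11D.
have BN x y : B x (- y) = - B x y by rewrite /B mulmxN Remx11N.
change (B u v = 4^-1 * (B (u + v) (u + v) - B (u - v) (u - v))).
clearbody B.
rewrite !BD !BN !(BC (u + v)) !(BC (u - v)) !BD !BN (BC v u).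
by field.
Qed.

Lemma delta_form n (A : 'M[C]_n) (c : C) i j :
  ((delta_mx i 0 : 'cV[C]_n)^t* *m A *m (c *: (delta_mx j 0 : 'cV[C]_n))) 0 0 = c * A i j.
Proof.
by rewrite trmx_delta map_delta_mx -scalemxAr mxE -rowE -colE !mxE.
Qed.

Lemma cvg_rsum (I : finType) (F : I -> nat -> R) (l : I -> R) :
  (forall i, F i @ \oo --> l i) ->
  (fun N => \sum_i F i N) @ \oo --> \sum_i l i.
Proof. by move=> h; apply: cvg_big => //; exact: add_continuous. Qed.

(** The quadratic forms decrease and are bounded below; polarisation gives an entrywise limit.
    Because the limit dominates a positive multiple of the identity, convergence can be stated
    multiplicatively, the form that suits perspectives. *)
Lemma lel_dec_limit n (X : nat -> 'M[C]_n) (m : R) : 0 < m ->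
  (forall N, loewner_le (m%:C)%:M (X N)) ->
  (forall N, loewner_le (X N.+1) (X N)) ->
  exists Y, [/\ loewner_le (m%:C)%:M Y, forall N, loewner_le Y (X N) &
    forall e, 0 < e -> exists N, loewner_le (X N) ((1 + e)%:C *: Y)].
Proof.
move=> m0 mX decX.
have hX N : (X N)^t* = X N := pd_ctmx (pd_lel (pd_scalar n m0) (mX N)).
pose q (v : 'cV[C]_n) N := Re ((v^t* *m X N *m v) 0 0).
have subE (A B : 'M[C]_n) (v : 'cV[C]_n) : Re ((v^t* *m (A - B) *m v) 0 0) =
    Re ((v^t* *m A *m v) 0 0) - Re ((v^t* *m B *m v) 0 0).
  by rewrite mulmxBr mulmxBl Remx11D Remx11N.
have leE (A B : 'M[C]_n) (v : 'cV[C]_n) : loewner_le A B ->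
    Re ((v^t* *m A *m v) 0 0) <= Re ((v^t* *m B *m v) 0 0).
  by move=> AB; have := AB.2 v; rewrite lecE => /andP[_]; rewrite subE subr_ge0.
have qcvg v : cvgn (q v).
  apply: nonincreasing_is_cvgn.
    by apply/nonincreasing_seqP => N; exact: leE.
  exists (Re ((v^t* *m (m%:C)%:M *m v) 0 0)) => _ [N _ <-]; exact: leE.
have bcvg (u v : 'cV[C]_n) : cvgn (fun N => Re ((u^t* *m X N *m v) 0 0)).
  rewrite (_ : (fun N => _) = (fun N => 4^-1 * (q (u + v) N - q (u - v) N))).
    by apply: is_cvgMr; apply: is_cvgB.
  by apply/funext => N; rewrite Re_form_polar.
have Recvg i j : cvgn (fun N => Re (X N i j)).
  have := bcvg (delta_mx i 0) (1 *: delta_mx j 0).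
  by under eq_fun do rewrite delta_form mul1r.
have Imcvg i j : cvgn (fun N => Im (X N i j)).
  (* The real part of [- 'i * z] is the imaginary part of [z]. *)
  have := bcvg (delta_mx i 0) (- 'i *: delta_mx j 0).
  under eq_fun do rewrite delta_form.
  rewrite (_ : (fun N => _) = (fun N => Im (X N i j)))//.
  by apply/funext => N; rewrite ReM /= ; ring.
pose Y : 'M[C]_n := \matrix_(i, j)
  (limn (fun N => Re (X N i j)) +i* limn (fun N => Im (X N i j))).
have hY : Y^t* = Y.
  apply/matrixP => i j; rewrite !mxE.
  have eX N : X N i j = (X N j i)^* by rewrite -{1}(hX N) !mxE.
  have -> : (fun N => Re (X N i j)) = (fun N => Re (X N j i)).
    by apply/funext => N; rewrite eX; case: (X N j i).
  have -> : (fun N => Im (X N i j)) = (fun N => - Im (X N j i)).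
    by apply/funext => N; rewrite eX; case: (X N j i).
  by rewrite limN.
have qY v : q v N @[N --> \oo] --> Re ((v^t* *m Y *m v) 0 0).
  have -> : q v = fun N => \sum_j \sum_i
      (Re ((v i 0)^* * v j 0) * Re (X N i j) - Im ((v i 0)^* * v j 0) * Im (X N i j)).
    by apply/funext => N; rewrite /q Re_form.
  rewrite Re_form; apply: cvg_rsum => j; apply: cvg_rsum => i.
  by rewrite !mxE; apply: cvgB; apply: cvgMr; [exact: Recvg|exact: Imcvg].
have leqY v N : Re ((v^t* *m Y *m v) 0 0) <= q v N.
  rewrite -(cvg_lim _ (qY v))//; apply: nonincreasing_cvgn_ge => //.
  by apply/nonincreasing_seqP => K; exact: leE.
have YX N : loewner_le Y (X N).
  apply: psd_Re => [|v]; first by rewrite ctmxB hX hY.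
  by rewrite subE subr_ge0; exact: leqY.
have mY : loewner_le (m%:C)%:M Y.
  apply: psd_Re => [|v]; first by rewrite ctmxB hY ctmx_scalar.
  rewrite subE subr_ge0 -(cvg_lim _ (qY v))//; apply: limr_ge => //.
  by apply: nearW => N; exact: leE.
exists Y; split=> // e e0.
have trcvg : (fun N => \sum_i (Re (X N i i) - Re (Y i i))) @ \oo --> (0 : R).
  rewrite -[X in _ --> X](_ : \sum_(i < n) (0 : R) = _); last by rewrite big1.
  apply: cvg_rsum => i; rewrite -[X in _ --> X](subrr (Re (Y i i))).
  by apply: cvgB; [rewrite mxE /=; exact: Recvg|exact: cvg_cst].
(* Once the trace of [X N - Y] is below [e * m], this difference is at most [e m I], hence at most
   [e Y]. *)
have em : 0 < e * m by rewrite mulr_gt0.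
move/cvgrPdist_lt: trcvg => /(_ _ em) [N _ /(_ N (leqnn N))].
rewrite sub0r normrN => hN; exists N.
have trE : Re (\tr (X N - Y)) = \sum_i (Re (X N i i) - Re (Y i i)).
  rewrite /mxtrace Re_sum; apply: eq_bigr => i _; rewrite !mxE.
  by case: (X N i i) => a b.
apply: (@lel_trans _ _ (Y + (e * m)%:C%:M)).
  rewrite -[X in loewner_le X _](subrK Y) [X in loewner_le X _]addrC.
  apply: lelD; first exact: lel_refl.
  apply: lel_trans (psd_le_trace (YX N)) (lel_scalar _ _).
  by rewrite trE; apply: le_trans (ltW hN); exact: ler_norm.
rewrite rmorphD scalerDl scale1r; apply: lelD; first exact: lel_refl.
by rewrite rmorphM -scale_scalar_mx; apply: lelZ; first exact: ltW.
Qed.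

End MonotoneLimit.

(** * Existence of Karcher means *)

Section Karcher.
Variable R : realType.
Local Notation C := R[i].

Lemma om_affine (a b : R) (h : R -> R) : 0 <= a -> operator_monotone h ->
  operator_monotone (fun x => a * h x + b).
Proof.
move=> a0 hm n A B pA pB AB; rewrite !mxfunE !fcalcD !fcalcZ !fcalc_cst.
apply: lelD; last exact: lel_refl.
exact: lelZ a0 (om_fcalc hm pA pB AB).
Qed.

Lemma om_comp_affine (a b : R) (h : R -> R) : 0 < a -> 0 <= b ->
  operator_monotone h -> operator_monotone (fun x => h (a * x + b)).
Proof.
move=> a0 b0 hm n A B pA pB AB; rewrite !mxfunE.
have E (X : 'M[C]_n) : pdmx X ->
    fcalc (fun x => h (a * x + b)) X = fcalc h (a%:C *: X + (b%:C)%:M).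
  by move=> /pd_ctmx hX; rewrite -(fcalc_affine a b hX) fcalc_comp.
have pE (X : 'M[C]_n) : pdmx X -> pdmx (a%:C *: X + (b%:C)%:M).
  move=> pX; apply: pdD; first exact: pdZ.
  by rewrite -scalemx1; apply: psdZ b0 (pd_psd (pd1 R n)).
rewrite (E _ pA) (E _ pB); apply: (om_fcalc hm (pE _ pA) (pE _ pB)).
by apply: lelD (lel_refl _); apply: lelZ (ltW a0) AB.
Qed.

Lemma om_scale (a : R) (h : R -> R) : 0 <= a -> operator_monotone h ->
  operator_monotone (fun x => a * h x).
Proof.
move=> a0 hm n A B pA pB AB; rewrite !mxfunE !fcalcZ.
exact: lelZ a0 (om_fcalc hm pA pB AB).
Qed.

(* For [0 < c < 1] this is bounded below on [(0, +oo)], and it decreases to [g]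
   as [c] increases to [1]. *)
Definition damp (g : R -> R) (c x : R) : R := c^-1 * g (c * x + (1 - c)).

Lemma damp_id g x : damp g 1 x = g x.
Proof. by rewrite /damp invr1 subrr addr0 !mul1r. Qed.

Lemma damp1 g c : g 1 = 0 -> damp g c 1 = 0.
Proof. by rewrite /damp mulr1 subrKC => ->; rewrite mulr0. Qed.

Lemma damp_om g c : 0 < c -> c <= 1 -> operator_monotone g ->
  operator_monotone (damp g c).
Proof.
move=> c0 c1 gm; apply: om_scale; first by rewrite invr_ge0 ltW.
by apply: om_comp_affine => //; rewrite subr_ge0.
Qed.

(** The point [c x + 1 - c] is the convex combination of [c' x + 1 - c'] and 1 with weight [c / c']
    on the former; concavity and [g 1 = 0] conclude. The case [c' = 1] compares with [g] itself. *)
Lemma damp_anti g c c' x : 0 < c -> c <= c' -> c' <= 1 ->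
  operator_monotone g -> g 1 = 0 -> 0 < x -> damp g c' x <= damp g c x.
Proof.
move=> c0 cc' c'1 gm g1 x0; have c'0 : 0 < c' by lra.
have t0 : 0 <= c / c' by rewrite divr_ge0 ?ltW.
have t1 : 0 <= 1 - c / c' by rewrite subr_ge0 ler_pdivrMr// mul1r.
have y0 : 0 < c' * x + (1 - c') by rewrite ltr_wpDr ?mulr_gt0// subr_ge0.
have := om_concave1 gm y0 ltr01 t0 t1 (subrKC _ _).
rewrite g1 mulr0 addr0.
have -> : c / c' * (c' * x + (1 - c')) + (1 - c / c') * 1 = c * x + (1 - c).
  by field; rewrite gt_eqF.
move=> h; rewrite /damp -(ler_pM2l c0) [leRHS]mulrA divff ?gt_eqF// mul1r.
by rewrite mulrA.
Qed.

(** The argument of [g] never falls below [1 - c]. *)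
Lemma damp_lbound g c : 0 < c -> c < 1 -> operator_monotone g -> g 1 = 0 ->
  exists2 b, 0 <= b & forall x, 0 < x -> - b <= damp g c x.
Proof.
move=> c0 c1 gm g1; exists (- (c^-1 * g (1 - c))).
  rewrite oppr_ge0 pmulr_rle0 ?invr_gt0// -g1.
  by apply: om_le => //; lra.
move=> x x0; rewrite opprK ler_pM2l ?invr_gt0//; apply: om_le => //; first by lra.
by rewrite lerDr mulr_ge0 ?ltW.
Qed.

Lemma damp_near g r e : operator_monotone g -> g 1 = 0 ->
  0 < r -> r <= 1 -> 0 < e ->
  exists N0 : nat, forall N, (N0 <= N)%N -> forall x, r <= x <= r^-1 ->
    damp g (N.+1%:R / N.+2%:R) x <= g x + e.
Proof.
move=> gm g1 r0 r1 e0.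
have r1' : 1 <= r^-1 by rewrite invf_ge1.
have e20 : 0 < e / 2 by lra.
have [s s0 hs] := om_right_unif gm r0 (le_trans r1 r1') e20.
pose G := g r^-1.
have G0 : 0 <= G by rewrite /G -g1; apply: om_le.
(* The first threshold controls the shift of the argument, the second the prefactor: [c^-1] is split
   as [1 + 1 / (N + 1)], and [G] bounds [g] on [[r, r^-1]]. *)
have d0 : 0 < Num.min (s * r) (e / 2 / (G + e)).
  by rewrite lt_min mulr_gt0//= divr_gt0//; lra.
set d := Num.min _ _ in d0.
have [N0 hN0] : exists N0 : nat, d^-1 < N0%:R.
  by exists (Num.truncn d^-1).+1; exact: truncnS_gt.
exists N0 => N NN x /andP[rx xr].
have Nd : (N.+1%:R : R)^-1 <= d.
  rewrite -[leRHS]invrK lef_pV2 ?posrE ?invr_gt0 ?ltr0n//.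
  by apply: le_trans (ltW hN0) _; rewrite ler_nat leqW.
set c : R := N.+1%:R / N.+2%:R.
have N1 : N.+1%:R != 0 :> R by rewrite pnatr_eq0.
have N2 : N.+1%:R + 1 != 0 :> R by rewrite natr1 pnatr_eq0.
have cE : 1 - c = (N.+2%:R)^-1.
  by rewrite /c -[N.+2%:R]natr1; move: (N.+1%:R) N1 N2 => a a0 a1; field.
have cV : c^-1 - 1 = (N.+1%:R)^-1.
  rewrite /c -[N.+2%:R]natr1; move: (N.+1%:R) N1 N2 => a a0 a1.
  by field; rewrite a0 a1.
have c0 : 0 < c by rewrite divr_gt0 ?ltr0n.
have cd : 1 - c <= d.
  by rewrite cE (le_trans _ Nd)// lef_pV2 ?posrE ?ltr0n// ler_nat.
have c1 : 0 < 1 - c by rewrite cE invr_gt0 ltr0n.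
have dsr : d <= s * r by rewrite ge_min lexx.
have de : d <= e / 2 / (G + e) by rewrite ge_min lexx orbT.
have x0 : 0 < x by lra.
have h1 : g (c * x + (1 - c)) <= g x + e / 2.
  apply: le_trans (hs x _); last by rewrite rx xr.
  apply: om_le => //; first by rewrite addr_gt0// mulr_gt0.
  have : (1 - c) * (1 - x) <= s * r.
    have := mulr_gt0 c1 x0; lra.
  have := ler_wpM2l (ltW s0) rx; lra.
have h2 : g x <= G by apply: om_le.
rewrite /damp -(subrK 1 c^-1) cV mulrDl mul1r.
have h3 : N.+1%:R^-1 * g (c * x + (1 - c)) <= N.+1%:R^-1 * (G + e).
  by rewrite ler_pM2l ?invr_gt0 ?ltr0n//; lra.
have h4 : N.+1%:R^-1 * (G + e) <= e / 2.
  by rewrite -ler_pdivlMr; [exact: le_trans Nd de|lra].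
by apply: le_trans (lerD (le_trans h3 h4) h1) _; lra.
Qed.

(** * The weighted sum of perspectives: its fixed points and zeros *)

Section Mean.
Variables (n k : nat) (w : 'I_n -> R) (A : 'I_n -> 'M[C]_k).
Hypotheses (hw : weight_vector w) (pA : forall i, pdmx (A i)).

Definition kmean (h : R -> R) (X : 'M[C]_k) : 'M[C]_k :=
  \sum_i (w i)%:C *: persp h X (A i).

Let w0 i : 0 <= w i := ltW (hw.1 i).

Lemma wsum_cst (X : 'M[C]_k) : \sum_i (w i)%:C *: X = X.
Proof. by rewrite -scaler_suml -rmorph_sum hw.2 scale1r. Qed.

(** With [b = 1] and [a] nonzero, a zero for [h] becomes a fixed point for [a h + 1]. *)
Lemma kmean_affine (a b : R) h X : psdmx X ->
  kmean (fun x => a * h x + b) X = a%:C *: kmean h X + b%:C *: X.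
Proof.
move=> pX; rewrite -[X in _ + _ *: X]wsum_cst /kmean !scaler_sumr -big_split.
apply: eq_bigr => i _; rewrite (persp_affine _ _ _ _ pX) scalerDr !scalerA.
by rewrite ![a%:C * _]mulrC ![b%:C * _]mulrC.
Qed.

Lemma kmean_le h X Y : operator_monotone h -> (forall x, 0 < x -> 0 <= h x) ->
  pdmx X -> pdmx Y -> loewner_le X Y -> loewner_le (kmean h X) (kmean h Y).
Proof.
move=> hm h0 pX pY XY; apply: lel_sum => i; apply: lelZ (w0 i) _.
exact: (persp_le hm h0 pX pY (pA i) XY).
Qed.

Lemma kmean_le_fun f h X : pdmx X -> (forall x, 0 < x -> f x <= h x) ->
  loewner_le (kmean f X) (kmean h X).
Proof.
move=> pX fh; apply: lel_sum => i; apply: lelZ (w0 i) _.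
exact: (persp_le_fun pX (pA i) fh).
Qed.

Lemma kmean_scale_le h (t : R) X : operator_monotone h -> 1 <= t -> pdmx X ->
  loewner_le (kmean h (t%:C *: X)) (t%:C *: kmean h X).
Proof.
move=> hm t1 pX; rewrite /kmean scaler_sumr; apply: lel_sum => i.
rewrite scalerA (mulrC t%:C) -scalerA; apply: lelZ (w0 i) _.
exact: (persp_scale_le hm t1 pX (pA i)).
Qed.

Lemma kmean_le_self h X : operator_monotone h -> h 1 = 1 -> pdmx X ->
  (forall i, loewner_le (A i) X) -> loewner_le (kmean h X) X.
Proof.
move=> hm h1 pX AX; rewrite -[Y in loewner_le _ Y]wsum_cst.
apply: lel_sum => i; apply: lelZ (w0 i) _.
by have := persp_le_self hm pX (pA i) (AX i); rewrite h1 scale1r.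
Qed.

Lemma kmean_ge_self h X : operator_monotone h -> h 1 = 1 -> pdmx X ->
  (forall i, loewner_le X (A i)) -> loewner_le X (kmean h X).
Proof.
move=> hm h1 pX AX; rewrite -[Y in loewner_le Y _]wsum_cst.
apply: lel_sum => i; apply: lelZ (w0 i) _.
by have := persp_ge_self hm pX (pA i) (AX i); rewrite h1 scale1r.
Qed.

Lemma kmean_le_near (a b e : R) f h X : pdmx X ->
  (forall i, loewner_le (a%:C *: X) (A i)) ->
  (forall i, loewner_le (A i) (b%:C *: X)) ->
  (forall x, a <= x <= b -> f x <= h x + e) ->
  loewner_le (kmean f X) (kmean h X + e%:C *: X).
Proof.
move=> pX aA Ab fh; rewrite -[Y in _ + _ *: Y]wsum_cst scaler_sumr -big_split.
apply: lel_sum => i /=; rewrite scalerA (mulrC e%:C) -scalerA -scalerDr.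
apply: lelZ (w0 i) _; exact: persp_le_near (pA i) (aA i) (Ab i) fh.
Qed.

Lemma kmean_lsc (g : R -> R) (r e : R) : operator_monotone g -> g 1 = 0 ->
  0 < r -> r <= r^-1 -> 0 < e ->
  exists2 d, 0 < d & forall X Y, pdmx X -> pdmx Y ->
    loewner_le X Y -> loewner_le Y ((1 + d)%:C *: X) ->
    (forall i, loewner_le (r%:C *: Y) (A i)) ->
    (forall i, loewner_le (A i) ((r^-1)%:C *: Y)) ->
    loewner_le (kmean g X) (kmean g Y + e%:C *: Y).
Proof.
move=> gm g1 r0 r1 e0; have [d d0 hd] := persp_lsc gm g1 r0 r1 e0.
exists d; first exact: d0.
move=> X Y pX pY XY YX rA Ar.
rewrite -[Z in _ + _ *: Z]wsum_cst scaler_sumr -big_split.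
apply: lel_sum => i /=; rewrite scalerA (mulrC e%:C) -scalerA -scalerDr.
apply: lelZ (w0 i) _; exact: hd pX pY (pA i) XY YX (rA i) (Ar i).
Qed.

Variables m M : R.
Hypotheses (m0 : 0 < m) (mM : m <= M).
Hypothesis mA : forall i, loewner_le (m%:C)%:M (A i).
Hypothesis AM : forall i, loewner_le (A i) (M%:C)%:M.

Let M0 : 0 < M := lt_le_trans m0 mM.
Let pm := pd_scalar k m0.
Let pM := pd_scalar k M0.

(** Monotone iteration from [M I], which stays above [m I]. Any [Z <= M I] with [Z <= kmean h Z]
    stays below all iterates; this maximality later orders the solutions of the damped equations. *)
Lemma kmean_fixpoint h : operator_monotone h ->
  (forall x, 0 < x -> 0 <= h x) -> h 1 = 1 ->
  exists X, [/\ loewner_le (m%:C)%:M X, loewner_le X (M%:C)%:M, kmean h X = X &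
    forall Z, pdmx Z -> loewner_le Z (M%:C)%:M ->
      loewner_le Z (kmean h Z) -> loewner_le Z X].
Proof.
move=> hm h0 h1.
pose X N : 'M[C]_k := iter N (kmean h) (M%:C)%:M.
have le_iter Z N : pdmx Z -> loewner_le Z (M%:C)%:M -> loewner_le Z (kmean h Z) ->
    loewner_le Z (X N).
  move=> pZ ZM ZZ; elim: N => [|N IH]; first exact: ZM.
  exact: lel_trans ZZ (kmean_le hm h0 pZ (pd_lel pZ IH) IH).
have mX N : loewner_le (m%:C)%:M (X N).
  apply: (le_iter _ N pm (lel_scalar k mM)).
  exact: (kmean_ge_self hm h1 pm mA).
have pX N := pd_lel pm (mX N).
have decX N : loewner_le (X N.+1) (X N).
  elim: N => [|N IH]; first exact: (kmean_le_self hm h1 pM AM).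
  exact: (kmean_le hm h0 (pX N.+1) (pX N) IH).
have [Y [mY YX XY]] := lel_dec_limit m0 mX decX.
have pY := pd_lel pm mY.
have YM := YX 0%N.
exists Y; split; [exact: mY|exact: YM| |].
  have YN N : loewner_le (kmean h Y) (X N.+1).
    exact: (kmean_le hm h0 pY (pX N) (YX N)).
  apply: lel_anti.
    apply: (lel_ext (pd_psd pY)) => e e0; have [N hN] := XY e e0.
    apply: lel_trans (YN N) _; apply: lel_trans (decX N) _.
    by move: hN; rewrite rmorphD scalerDl scale1r.
  have psK : psdmx (kmean h Y).
    apply: psd_sum => i; apply: psdZ (w0 i) _.
    rewrite /persp unrelmxE -{1}rtmx_ctmx; apply: psd_congr.
    by apply: psd_fcalc => x /(spec_gt0 (relmx_pd pY (pA i))); exact: h0.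
  (* Subhomogeneity stands in for continuity: [Y <= X N.+1 <= kmean h ((1 + e) Y) <= (1 + e) kmean h
     Y]. *)
  apply: (lel_ext psK) => e e0; have [N hN] := XY e e0.
  apply: lel_trans (YX N.+1) _.
  have e1 : 1 <= 1 + e by rewrite lerDl ltW.
  have pe : pdmx ((1 + e)%:C *: Y) by apply: pdZ pY; exact: lt_le_trans e1.
  apply: lel_trans (kmean_le hm h0 (pX N) pe hN) _.
  apply: lel_trans (kmean_scale_le hm e1 pY) _.
  by rewrite rmorphD scalerDl scale1r; exact: lel_refl.
move=> Z pZ ZM ZZ; apply: (lel_ext (pd_psd pY)) => e e0.
have [N hN] := XY e e0.
apply: lel_trans (le_iter Z N pZ ZM ZZ) _.
by move: hN; rewrite rmorphD scalerDl scale1r.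
Qed.

Lemma kmean_zero_bounded g b : operator_monotone g -> g 1 = 0 ->
  0 <= b -> (forall x, 0 < x -> - b <= g x) ->
  exists X, [/\ loewner_le (m%:C)%:M X, loewner_le X (M%:C)%:M, kmean g X = 0 &
    forall Z, pdmx Z -> loewner_le Z (M%:C)%:M ->
      loewner_le 0 (kmean g Z) -> loewner_le Z X].
Proof.
(* This scaling makes [c g + 1] nonnegative, with value 1 at 1, so the fixed point lemma applies. *)
move=> gm g1 b0 gb; pose c := (b + 1)^-1.
have b1 : 0 < b + 1 by lra.
have c0 : 0 < c by rewrite invr_gt0.
have hm := om_affine 1 (ltW c0) gm.
have h0 x : 0 < x -> 0 <= c * g x + 1.
  move=> x0; have : c * (- b) <= c * g x by rewrite ler_pM2l// gb.
  have : c * (b + 1) = 1 by rewrite mulVf// gt_eqF.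
  lra.
have h1 : c * g 1 + 1 = 1 by rewrite g1 mulr0 add0r.
have [X [mX XM fX maxX]] := kmean_fixpoint hm h0 h1.
exists X; split; [exact: mX|exact: XM| |].
  move: fX; rewrite (kmean_affine _ _ _ (pd_psd (pd_lel pm mX))) scale1r.
  move/(congr1 (fun Y => Y - X)); rewrite addrK subrr => /eqP.
  by rewrite scaler_eq0 => /orP[|/eqP//]; rewrite eq_complex /= gt_eqF.
move=> Z pZ ZM Z0; apply: (maxX Z pZ ZM).
rewrite (kmean_affine _ _ _ (pd_psd pZ)) scale1r /loewner_le addrK.
by apply: psdZ (ltW c0) _; move: Z0; rewrite /loewner_le subr0.
Qed.

(** The factor 2 leaves room for the slightly enlarged limit [(1 + d') Y] with [d' <= 1] in the
    proof of [kmean_zero]. *)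
Lemma scaled_bounds X : loewner_le (m%:C)%:M X -> loewner_le X ((2 * M)%:C)%:M ->
  (forall i, loewner_le ((m / (2 * M))%:C *: X) (A i)) /\
  (forall i, loewner_le (A i) (((m / (2 * M))^-1)%:C *: X)).
Proof.
move=> mX XM; have M2 : 0 < 2 * M by rewrite mulr_gt0.
have r0 : 0 <= m / (2 * M) by rewrite divr_ge0 ?ltW.
have rM : m / (2 * M) * (2 * M) = m by rewrite divfK// gt_eqF.
split=> i.
  by apply: lel_trans (lelZ r0 XM) _; rewrite scalar_mxZ rM; exact: mA.
have r0' : 0 <= (m / (2 * M))^-1 by rewrite invr_ge0.
apply: lel_trans (AM i) _; apply: lel_trans (lelZ r0' mX).
rewrite scalar_mxZ; apply: lel_scalar.
by rewrite invf_div divfK ?gt_eqF//; lra.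
Qed.

Lemma kmean_zero g : operator_monotone g -> g 1 = 0 ->
  exists2 X, pdmx X & kmean g X = 0.
Proof.
move=> gm g1.
pose c (N : nat) : R := N.+1%:R / N.+2%:R.
have cE N : c N = 1 - N.+2%:R^-1.
  have : N.+1%:R + 1 != 0 :> R by rewrite natr1 pnatr_eq0.
  by rewrite /c -[N.+2%:R]natr1; move: (N.+1%:R) => a a1; field.
have Np (N : nat) : (0 : R) < N.+2%:R^-1 by rewrite invr_gt0 ltr0n.
have c0 N : 0 < c N by rewrite divr_gt0 ?ltr0n.
have c1 N : c N < 1 by rewrite cE ltrBlDr ltrDl.
have cS N : c N <= c N.+1.
  by rewrite !cE lerD2l lerN2 lef_pV2 ?posrE ?ltr0n// ler_nat.
have dm N := damp_om (c0 N) (ltW (c1 N)) gm.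
have [X hX] : exists X : nat -> 'M[C]_k, forall N,
    [/\ loewner_le (m%:C)%:M (X N), loewner_le (X N) (M%:C)%:M,
        kmean (damp g (c N)) (X N) = 0 &
        forall Z, pdmx Z -> loewner_le Z (M%:C)%:M ->
          loewner_le 0 (kmean (damp g (c N)) Z) -> loewner_le Z (X N)].
  have E N : {X : 'M[C]_k | [/\ loewner_le (m%:C)%:M X, loewner_le X (M%:C)%:M,
        kmean (damp g (c N)) X = 0 &
        forall Z, pdmx Z -> loewner_le Z (M%:C)%:M ->
          loewner_le 0 (kmean (damp g (c N)) Z) -> loewner_le Z X]}.
    apply: cid; have [b b0 hb] := damp_lbound (c0 N) (c1 N) gm g1.
    exact: (kmean_zero_bounded (dm N) (damp1 _ g1) b0 hb).
  by exists (fun N => sval (E N)) => N; case: (E N).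
have mX N : loewner_le (m%:C)%:M (X N) by case: (hX N).
have XM N : loewner_le (X N) (M%:C)%:M by case: (hX N).
have zX N : kmean (damp g (c N)) (X N) = 0 by case: (hX N).
have pX N := pd_lel pm (mX N).
(* Damping decreases with [N], so the sum for [damp g (c N)] is nonnegative at [X N.+1], and
   maximality of [X N] applies. *)
have decX N : loewner_le (X N.+1) (X N).
  have [_ _ _ maxX] := hX N; apply: (maxX _ (pX N.+1) (XM N.+1)).
  rewrite -[Z in loewner_le Z _](zX N.+1); apply: (kmean_le_fun (pX N.+1)) => x x0.
  exact: damp_anti (c0 N) (cS N) (ltW (c1 N.+1)) gm g1 x0.
have [Y [mY YX XY]] := lel_dec_limit m0 mX decX.
have pY := pd_lel pm mY.
have YM := lel_trans (YX 0%N) (XM 0%N).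
have XY' e : 0 < e -> exists N0, forall N, (N0 <= N)%N ->
    loewner_le (X N) ((1 + e)%:C *: Y).
  move=> /XY[N0 hN0]; exists N0 => N /subnKC <-; move: (N - N0)%N => j.
  elim: j => [|j IH]; first by rewrite addn0.
  by rewrite addnS; exact: lel_trans (decX _) IH.
have M2 : M <= 2 * M by rewrite ler_peMl ?(ltW M0)// ler1n.
have XM2 N := lel_trans (XM N) (lel_scalar k M2).
pose r := m / (2 * M).
have r0 : 0 < r by rewrite divr_gt0// mulr_gt0.
have r1 : r <= 1 by rewrite ler_pdivrMr ?mulr_gt0// mul1r; exact: le_trans M2.
have rr : r <= r^-1 by rewrite (le_trans r1)// invf_ge1.
exists Y; first exact: pY.
apply: lel_anti.
  (* Upper half: [g] lies below its damped versions, so [kmean g (X N) <= 0], and [kmean_lsc] for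
     [Y <= X N] transfers this to [Y] up to [e]. *)
  apply: (lel_ext (pd_psd pM)) => e e0; rewrite add0r.
  have [d d0 hd] := kmean_lsc gm g1 r0 rr e0.
  have [N hN] := XY d d0.
  have [rA Ar] := scaled_bounds (mX N) (XM2 N).
  apply: lel_trans (hd _ _ pY (pX N) (YX N) hN rA Ar) _.
  rewrite -[Z in loewner_le _ Z]add0r; apply: lelD.
    rewrite -[Z in loewner_le _ Z](zX N); apply: (kmean_le_fun (pX N)) => x x0.
    rewrite -[leLHS](damp_id g).
    exact: damp_anti (c0 N) (ltW (c1 N)) (lexx 1) gm g1 x0.
  exact: lelZ (ltW e0) (XM N).
(* Lower half: [kmean_lsc] bounds the smaller matrix by the larger, so [Y] is enlarged to
   [Y' = (1 + d') Y], which lies above [X N]; subhomogeneity then returns from [Y'] to [Y]. The two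
   errors [e Y'] and at most [e Y'] add up to the multiple of [2 Y]. *)
have psD : psdmx (2%:C *: Y) by apply: psdZ (pd_psd pY).
apply: (lel_ext psD) => e e0.
have [d d0 hd] := kmean_lsc gm g1 r0 rr e0.
(* At most [d] for [Y' <= (1 + d) X N], at most 1 for [Y' <= 2 M I]. *)
pose d' := Num.min d 1.
have d'0 : 0 < d' by rewrite lt_min d0 ltr01.
have d'd : d' <= d by rewrite ge_min lexx.
have d'1 : d' <= 1 by rewrite ge_min lexx orbT.
have [N0 hN0] := XY' d' d'0.
have [N1 hN1] : exists N1, forall N, (N1 <= N)%N -> forall x, r <= x <= r^-1 ->
    damp g (c N) x <= g x + e.
  exact: damp_near.
pose N := maxn N0 N1.
have XNY := hN0 N (leq_maxl _ _); have gN := hN1 N (leq_maxr _ _).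
have d1p : 0 < 1 + d' by lra.
pose Y' : 'M[C]_k := (1 + d')%:C *: Y.
have YY' : loewner_le Y Y'.
  rewrite /Y' rmorphD scalerDl scale1r /loewner_le addrC addKr.
  exact: psdZ (ltW d'0) (pd_psd pY).
have pY' : pdmx Y' := pdZ d1p pY.
have mY' := lel_trans mY YY'.
have Y'M : loewner_le Y' ((2 * M)%:C)%:M.
  apply: lel_trans (lelZ (ltW d1p) YM) _; rewrite scalar_mxZ.
  by apply: lel_scalar; rewrite ler_pM2r//; lra.
have [rX Xr] := scaled_bounds (mX N) (XM2 N).
have [rY Yr] := scaled_bounds mY' Y'M.
have Y'X : loewner_le Y' ((1 + d)%:C *: X N).
  apply: lel_trans (lelZ (ltW d1p) (YX N)) _.
  rewrite /loewner_le -scalerBl -rmorphB; apply: psdZ (pd_psd (pX N)).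
  by rewrite subr_ge0 lerD2l.
have h1 := kmean_le_near (pX N) rX Xr gN; rewrite zX in h1.
have h2 := hd _ _ (pX N) pY' XNY Y'X rY Yr.
have h3 : loewner_le (kmean g Y') ((1 + d')%:C *: kmean g Y).
  by apply: (kmean_scale_le gm _ pY); lra.
have h4 : loewner_le 0 ((1 + d')%:C *: (kmean g Y + e%:C *: (2%:C *: Y))).
  apply: lel_trans h1 _.
  apply: lel_trans (lelD h2 (lelZ (ltW e0) XNY)) _.
  rewrite -addrA; have -> : e%:C *: Y' + e%:C *: ((1 + d')%:C *: Y) =
      (1 + d')%:C *: (e%:C *: (2%:C *: Y)).
    rewrite -scalerDl !scalerA -rmorphD -!rmorphM.
    by apply: (f_equal (fun a : R => a%:C *: Y)); ring.
  by rewrite scalerDr; apply: lelD (lel_refl _).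
have i0 : 0 <= (1 + d')^-1 by rewrite invr_ge0 ltW.
have dV : (1 + d')^-1 * (1 + d') = 1 by rewrite mulVf// gt_eqF.
have := lelZ i0 h4.
by rewrite scaler0 (scalerA ((1 + d')^-1)%:C) -rmorphM dV scale1r.
Qed.

End Mean.
End Karcher.

(** * Bounds on Karcher means *)

Section KarcherMean.
Variable R : realType.
Local Notation C := R[i].

Lemma fcalc_inv_uniq n (A B : 'M[C]_n) : pdmx A -> A *m B = 1%:M ->
  fcalc GRing.inv A = B.
Proof.
move=> pA AB; rewrite -[LHS]mulmx1 -AB mulmxA (fcalc_inv pA).
exact: mul1mx.
Qed.

Lemma pd_inv n (A : 'M[C]_n) : pdmx A -> pdmx (fcalc GRing.inv A).
Proof. by move=> pA; apply: pd_fcalc => x /(spec_gt0 pA); rewrite invr_gt0. Qed.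

Lemma fcalc_invK n (A : 'M[C]_n) : pdmx A -> fcalc GRing.inv (fcalc GRing.inv A) = A.
Proof. by move=> pA; apply: (fcalc_inv_uniq (pd_inv pA)); exact: fcalc_inv. Qed.

Lemma relmx_inv n (X A : 'M[C]_n) : pdmx X -> pdmx A ->
  fcalc GRing.inv (relmx X A) = unrelmx X (fcalc GRing.inv A).
Proof.
move=> pX pA; apply: (fcalc_inv_uniq (relmx_pd pX pA)).
rewrite relmxE unrelmxE !mulmxA -(mulmxA _ (irtmx X) (rtmx X)) (irtmxK pX) mulmx1.
by rewrite -(mulmxA _ A) (fcalcV pA) mulmx1 (irtmxK pX).
Qed.

Lemma relmx1 n (X : 'M[C]_n) : pdmx X -> relmx X 1%:M = fcalc GRing.inv X.
Proof.
move=> pX; rewrite relmxE mulmx1 irtmxE -fcalcM; apply: eq_fcalc => x.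
move=> /(spec_gt0 pX) x0; rewrite -invfM -expr2 sqr_sqrtr//; exact: ltW.
Qed.

Lemma relmx_sum n (I : finType) (X : 'M[C]_n) (F : I -> 'M[C]_n) :
  relmx X (\sum_i F i) = \sum_i relmx X (F i).
Proof.
rewrite relmxE mulmx_sumr mulmx_suml; apply: eq_bigr => i _.
by rewrite relmxE.
Qed.

(** * Arithmetic and harmonic bounds, and the Kantorovich inequality *)

Section Bounds.
Variables (n k : nat) (w : 'I_n -> R) (A : 'I_n -> 'M[C]_k).
Hypotheses (hw : weight_vector w) (pA : forall i, pdmx (A i)).

Lemma karcherE g X :
  \sum_(i < n) (w i)%:C *: mxfun g (invsqrtmx X *m A i *m invsqrtmx X) =
  \sum_(i < n) (w i)%:C *: fcalc g (relmx X (A i)).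
Proof.
by apply: eq_bigr => i _; rewrite mxfunE relmxE irtmxE /invsqrtmx mxfunE.
Qed.

Lemma karcher_kmean g X : pdmx X ->
  \sum_(i < n) (w i)%:C *: fcalc g (relmx X (A i)) = relmx X (kmean w A g X).
Proof.
move=> pX; rewrite relmx_sum; apply: eq_bigr => i _.
by rewrite relmxZ /persp (unrelmxK _ pX).
Qed.

(** Existence shows that [xget] returns a genuine solution; the bounds below hold for every
    solution, hence for that one. *)
Lemma karcher_sigma g m M : operator_monotone g -> g 1 = 0 ->
  0 < m -> m <= M ->
  (forall i, loewner_le (m%:C)%:M (A i)) ->
  (forall i, loewner_le (A i) (M%:C)%:M) ->
  karcher_solution g w A (sigma g w A).
Proof.
move=> gm g1 m0 mM mA AM; rewrite /sigma.
have [X pX zX] := kmean_zero hw pA m0 mM mA AM gm g1.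
apply: (@xgetPex _ 0 [set X | karcher_solution g w A X]%classic); exists X.
split; first exact: pX.
by rewrite karcherE (karcher_kmean _ pX) zX relmxE mulmx0 mul0mx.
Qed.

(** The bound [g x <= x - 1] inserted in [kmean] gives [0 <= S - X], with [S] the arithmetic
    mean. *)
Lemma karcher_le_arith g X : class_L g -> karcher_solution g w A X ->
  loewner_le X (\sum_i (w i)%:C *: A i).
Proof.
case=> gm g1 dg [pX]; rewrite karcherE (karcher_kmean _ pX).
move=> /(congr1 (unrelmx X)); rewrite (relmxK _ pX) => zX.
have {}zX : kmean w A g X = 0 by rewrite zX unrelmxE mulmx0 mul0mx.
have gl x : 0 < x -> g x <= 1 * id x + -1.
  by move=> x0; rewrite mul1r; exact: om_le_tangent.
have := kmean_le_fun hw pA pX gl.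
rewrite zX (kmean_affine A hw 1 (-1) id (pd_psd pX)) scale1r rmorphN1 scaleN1r.
rewrite /loewner_le subr0 (_ : kmean w A id X = \sum_i (w i)%:C *: A i)//.
apply: eq_bigr => i _; rewrite /persp fcalc_id ?(pd_ctmx (relmx_pd pX (pA i)))//.
by rewrite (relmxK _ pX).
Qed.

Lemma harm_le_karcher g X : class_L g -> karcher_solution g w A X ->
  loewner_le (fcalc GRing.inv X) (\sum_i (w i)%:C *: fcalc GRing.inv (A i)).
Proof.
case=> gm g1 dg [pX]; rewrite karcherE => zX.
have gl x : 0 < x -> -1 * x^-1 + 1 <= g x.
  by move=> x0; rewrite mulN1r addrC; exact: om_ge_cotangent.
have le i : loewner_le ((w i)%:C *: fcalc (fun x => -1 * x^-1 + 1) (relmx X (A i)))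
                       ((w i)%:C *: fcalc g (relmx X (A i))).
  apply: lelZ (ltW (hw.1 i)) _; apply: fcalc_le => x.
  by move=> /(spec_gt0 (relmx_pd pX (pA i))); exact: gl.
(* Congruence by [X^(-1/2)] sends the identity to [X^-1] and the inverse of [relmx X (A i)] to the
   inverse of [A i]. *)
have := relmx_le X (lel_sum le).
rewrite zX !relmx_sum.
have -> : \sum_i relmx X ((w i)%:C *: fcalc (fun x => -1 * x^-1 + 1) (relmx X (A i)))
    = fcalc GRing.inv X - \sum_i (w i)%:C *: fcalc GRing.inv (A i).
  rewrite -[Y in Y - _](wsum_cst hw) -sumrB; apply: eq_bigr => i _.
  rewrite fcalcD fcalcZ fcalc_cst relmxZ relmxD relmxZ (relmx1 pX).
  rewrite (relmx_inv pX (pA i)) (unrelmxK _ pX) rmorphN1 scaleN1r.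
  by rewrite scalerDr scalerN addrC.
by rewrite relmxE mulmx0 mul0mx /loewner_le sub0r opprB.
Qed.

(** On [[m, M]], [x <= m + M - m M / x]. Averaging gives [S <= m + M - m M H], with [S] the
    arithmetic mean and [H] the mean of the inverses; completing the square bounds this by [K H^-1],
    and [H^-1 <= X] by inversion. *)
Lemma arith_le_kantorovich m M X : 0 < m -> m < M ->
  (forall i, loewner_le (m%:C)%:M (A i)) ->
  (forall i, loewner_le (A i) (M%:C)%:M) -> pdmx X ->
  loewner_le (fcalc GRing.inv X) (\sum_i (w i)%:C *: fcalc GRing.inv (A i)) ->
  loewner_le (\sum_i (w i)%:C *: A i) ((kantorovich (M / m))%:C *: X).
Proof.
move=> m0 mM mA AM pX; set H := \sum_i _ => XH.
have M0 : 0 < M by lra.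
have pH : pdmx H by apply: (pd_wsum hw) => i; exact: pd_inv.
have le i : loewner_le ((w i)%:C *: A i)
    ((w i)%:C *: fcalc (fun x => - (m * M) * x^-1 + (m + M)) (A i)).
  apply: lelZ (ltW (hw.1 i)) _; rewrite -{1}(fcalc_id (pd_ctmx (pA i))).
  apply: fcalc_le => x xA.
  have mx := spec_ge (pd_ctmx (pA i)) (mA i) xA.
  have xM := spec_le (pd_ctmx (pA i)) (AM i) xA.
  have x0 : 0 < x by lra.
  rewrite -subr_ge0 (_ : _ - _ = (M - x) * (x - m) / x).
    by rewrite divr_ge0 ?mulr_ge0 ?subr_ge0// ltW.
  by field; rewrite gt_eqF.
apply: lel_trans (lel_sum le) _.
have -> : \sum_i (w i)%:C *: fcalc (fun x => - (m * M) * x^-1 + (m + M)) (A i)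
    = fcalc (fun x => - (m * M) * x + (m + M)) H.
  rewrite (fcalc_affine _ _ (pd_ctmx pH)) -[Y in _ = _ + Y](wsum_cst hw).
  rewrite /H scaler_sumr -big_split; apply: eq_bigr => i _ /=.
  by rewrite fcalcD fcalcZ fcalc_cst scalerDr !scalerA mulrC.
apply: (@lel_trans _ _ (fcalc (fun x => kantorovich (M / m) * x^-1) H)).
  apply: fcalc_le => x /(spec_gt0 pH) x0.
  rewrite -subr_ge0 (_ : _ - _ = (m * M * x - (m + M) / 2) ^+ 2 / (m * M * x)).
    by rewrite divr_ge0 ?sqr_ge0// !mulr_ge0// ltW.
  by rewrite /kantorovich; field; rewrite !gt_eqF.
rewrite fcalcZ; apply: lelZ.
  by rewrite /kantorovich divr_ge0 ?sqr_ge0// mulr_ge0// divr_ge0// ltW.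
rewrite -[Y in loewner_le _ Y](fcalc_invK pX).
exact: inv_antitone (pd_inv pX) pH XH.
Qed.

End Bounds.

(** * Subhomogeneity, and reduction of decreasing functions *)

Lemma mxfun_scalar n (a : R) (f : R -> R) :
  mxfun f ((a%:C)%:M : 'M[C]_n) = ((f a)%:C)%:M.
Proof. by rewrite mxfunE fcalc_scalar. Qed.

Lemma kantorovich_ge1 (h : R) : 0 < h -> 1 <= kantorovich h.
Proof.
move=> h0; rewrite /kantorovich ler_pdivlMr ?mulr_gt0// mul1r -subr_ge0.
rewrite (_ : _ - _ = (h - 1) ^+ 2); [exact: sqr_ge0|by ring].
Qed.

(** Concavity between [K x] and a point near 0, where [f] is positive. The point [s x] plays the
    role of 0, and its contribution, at most [s x], is absorbed by right continuity. *)
Lemma om_subhom (f : R -> R) (K x : R) : operator_monotone f ->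
  (forall y, 0 < y -> 0 < f y) -> 1 <= K -> 0 < x -> f (K * x) <= K * f x.
Proof.
move=> fm f0 K1 x0; have K0 : 0 < K by lra.
have Kx : 0 < K * x by rewrite mulr_gt0.
have t0 : 0 <= K^-1 by rewrite invr_ge0 ltW.
have u0 : 0 <= 1 - K^-1 by rewrite subr_ge0 invf_le1.
suff : K^-1 * f (K * x) <= f x by rewrite ler_pdivrMl.
apply/ler_addgt0Pr => e e0.
have [s s0 hs] := om_right_unif fm x0 (lexx x) e0.
apply: le_trans (hs x _); last by rewrite lexx.
have sx : 0 < s * x by rewrite mulr_gt0.
have := om_concave1 fm Kx sx t0 u0 (subrKC _ _); rewrite mulKf ?gt_eqF// => h.
apply: le_trans (le_trans h _).
  by rewrite lerDl mulr_ge0// ltW// f0.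
apply: om_le => //; first by rewrite ltr_wpDr ?mulr_ge0// ltW.
by rewrite [leRHS]mulrDl mul1r lerD2l ler_piMl ?(ltW sx)// gerBl.
Qed.

Lemma om_fcalc_subhom n (f : R -> R) (K : R) (S X : 'M[C]_n) :
  operator_monotone f -> (forall y, 0 < y -> 0 < f y) -> 1 <= K ->
  pdmx S -> pdmx X -> loewner_le S (K%:C *: X) ->
  loewner_le (fcalc f S) (K%:C *: fcalc f X).
Proof.
move=> fm f0 K1 pS pX SX.
apply: lel_trans (om_fcalc fm pS (pd_lel pS SX) SX) _.
rewrite (fcalc_scale _ _ (pd_ctmx pX)) -fcalcZ; apply: fcalc_le => x.
by move=> /(spec_gt0 pX); exact: om_subhom.
Qed.

Lemma od_inv (f : R -> R) : operator_decreasing f -> (forall y, 0 < y -> 0 < f y) ->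
  operator_monotone (fun x => (f x)^-1).
Proof.
move=> fd f0 n A B pA pB AB; rewrite !mxfunE.
have E (X : 'M[C]_n) : fcalc (fun x => (f x)^-1) X = fcalc GRing.inv (fcalc f X).
  by rewrite fcalc_comp.
have pf (X : 'M[C]_n) : pdmx X -> pdmx (fcalc f X).
  by move=> pX; apply: pd_fcalc => x /(spec_gt0 pX); exact: f0.
rewrite !E; apply: (inv_antitone (pf _ pB) (pf _ pA)).
by rewrite -!mxfunE; exact: fd.
Qed.

End KarcherMean.

(** * The two inequalities *)

Theorem theorem4p1 (R : realType) (n k : nat) (g : R -> R) (w : 'I_n -> R)
    (A : 'I_n -> 'M[R[i]]_k) (m M : R)
    (hg : class_L g) (hw : weight_vector w)
    (hm : 0 < m) (hmM : m < M)
    (hA : forall i, pdmx (A i))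
    (hmA : forall i, loewner_le (m%:C)%:M (A i))
    (hAM : forall i, loewner_le (A i) (M%:C)%:M) :
  (forall f : R -> R, (forall x, 0 < x -> 0 < f x) -> operator_monotone f ->
    loewner_le (sigma g w (fun i => mxfun f (A i)))
               ((kantorovich (M / m))%:C *: mxfun f (sigma g w A))) /\
  (forall f : R -> R, (forall x, 0 < x -> 0 < f x) -> operator_decreasing f ->
    loewner_le (mxfun f (sigma g w A))
               ((kantorovich (M / m))%:C *:
                  sigma g w (fun i => mxfun f (A i)))).
Proof.
have [gm g1 dg] := hg.
have M0 : 0 < M := lt_trans hm hmM.
have mM := ltW hmM.
have K1 : 1 <= kantorovich (M / m) by apply: kantorovich_ge1; exact: divr_gt0.
have K0 : 0 < kantorovich (M / m) := lt_le_trans ltr01 K1.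
have sA := karcher_sigma hw hA gm g1 hm mM hmA hAM.
have pX := sA.1; set X := sigma g w A in sA pX *.
set K := kantorovich (M / m) in K1 K0 *.
pose S : 'M[R[i]]_k := \sum_i (w i)%:C *: A i.
have pS : pdmx S := pd_wsum hw hA.
have SX : loewner_le S (K%:C *: X).
  exact: (arith_le_kantorovich hw hA hm hmM hmA hAM pX (harm_le_karcher hw hA hg sA)).
clearbody K.
have pfA (f : R -> R) : (forall x, 0 < x -> 0 < f x) -> forall i, pdmx (mxfun f (A i)).
  by move=> f0 i; rewrite mxfunE; apply: pd_fcalc => x /(spec_gt0 (hA i)); exact: f0.
split=> f f0 fm.
  have sf : karcher_solution g w (fun i => mxfun f (A i))
      (sigma g w (fun i => mxfun f (A i))).
    apply: (karcher_sigma hw (pfA f f0) gm g1 (f0 m hm) (om_le fm hm mM)) => i.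
      by rewrite -mxfun_scalar; exact: fm (pd_scalar k hm) (hA i) (hmA i).
    by rewrite -mxfun_scalar; exact: fm (hA i) (pd_scalar k M0) (hAM i).
  (* The chain is: Karcher mean of the [f (A i)], their arithmetic mean, [f S] by concavity, and
     [K f X] by subhomogeneity. *)
  apply: lel_trans (karcher_le_arith hw (pfA f f0) hg sf) _.
  rewrite mxfunE; apply: lel_trans (om_fcalc_subhom fm f0 K1 pS pX SX).
  under eq_bigr do rewrite mxfunE.
  exact: om_concave_sum fm hw hA.
have fMm : f M <= f m.
  apply: (@lel_scalar1 R); rewrite -!mxfun_scalar.
  exact: fm (pd_scalar 1 hm) (pd_scalar 1 M0) (lel_scalar 1 mM).
have sf : karcher_solution g w (fun i => mxfun f (A i))
    (sigma g w (fun i => mxfun f (A i))).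
  (* Since [f] decreases, the spectral bounds of the [f (A i)] are exchanged: [f M] below, [f m]
     above. *)
  apply: (karcher_sigma hw (pfA f f0) gm g1 (f0 M M0) fMm) => i.
    by rewrite -mxfun_scalar; exact: fm (hA i) (pd_scalar k M0) (hAM i).
  by rewrite -mxfun_scalar; exact: fm (pd_scalar k hm) (hA i) (hmA i).
set Y := sigma g w _ in sf *; have pY := sf.1.
pose F x := (f x)^-1.
have Fm : operator_monotone F := od_inv fm f0.
have F0 x : 0 < x -> 0 < F x by move=> x0; rewrite invr_gt0; exact: f0.
have pFX : pdmx (fcalc F X).
  by apply: pd_fcalc => x /(spec_gt0 pX); exact: F0.
(* The same chain for [F = 1 / f], starting from the harmonic bound on [Y]; inverting the outcome
   gives [K^-1 f X <= Y]. *)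
have YF : loewner_le (fcalc GRing.inv Y) (K%:C *: fcalc F X).
  apply: lel_trans (harm_le_karcher hw (pfA f f0) hg sf) _.
  apply: lel_trans (om_fcalc_subhom Fm F0 K1 pS pX SX).
  have E i : fcalc GRing.inv (mxfun f (A i)) = fcalc F (A i).
    by rewrite mxfunE fcalc_comp.
  under eq_bigr do rewrite E.
  exact: om_concave_sum Fm hw hA.
have := inv_antitone (pd_inv pY) (pdZ K0 pFX) YF.
rewrite (fcalc_invK pY) (fcalc_scale _ _ (pd_ctmx pFX)) fcalc_comp.
have -> : fcalc ((fun x => (K * x)^-1) \o F) X = (K^-1)%:C *: fcalc f X.
  by rewrite -fcalcZ; apply: eq_fcalc => x _; rewrite /F /= invfM invrK.
move=> /(lelZ (ltW K0)).
by rewrite (scalerA K%:C) -rmorphM (divff (lt0r_neq0 K0)) scale1r mxfunE.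
Qed.
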